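(* Any realization of the two-dimensional noncommutative Lie algebra by vector fields on the circle $S^1$ (with vector fields from the class $\mathcal{C}$) is equivalent to a realization of the form $$\left\langle \sigma_k(\theta)\,(1-\cos(n\theta))\frac{d}{d\theta},\ \frac1n\sin(n\theta)\frac{d}{d\theta}\right\rangle$$ for some integer $n\ge 1$, where, for each $k=0,1,\dots,n-1$, $\sigma_k(\theta)=\pm1$ is constant on the interval $\left(\frac{2\pi k}{n},\frac{2\pi(k+1)}{n}\right)$ (the sign may differ from one interval to another).
   Context: The circle $S^1$ is parametrized by $\theta\in[0,2\pi)$. A vector field on $S^1$ is $v(\theta)\frac{d}{d\theta}$ with $v$ a real $2\pi$-periodic function; vector fields are of class $C^1$ (i.e. $v$ is continuously differentiable). The commutator is $\left[v\frac{d}{d\theta},w\frac{d}{d\theta}\right]=(vw'-v'w)\frac{d}{d\theta}$. A singular point of $v\frac{d}{d\theta}$ is a zero of $v$. The class $\mathcal{C}$ consists of the $C^1$ vector fields on $S^1$ whose set of singular points contains no nonempty open interval. A realization of the two-dimensional noncommutative algebra is a two-dimensional noncommutative Lie algebra of vector fields $\langle W,V\rangle$ with nonzero elements in $\mathcal{C}$; up to linear combinations, the generators satisfy $[V,W]=W$. An equivalence transformation is a map $f:S^1\to S^1$ such that: (i) $f$ is a one-to-one mapping of the circle onto itself; (ii) $f$ is continuous at every point; (iii) $f$ is continuously differentiable at all points except a finite number of them; (iv) $f'(\theta)$ tends to $-\infty$ or $+\infty$ at all points of discontinuity of $f'$; (v) under the change of coordinate $\tilde\theta=f(\theta)$ the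 $C^1$ vector fields to which the transformation is applied are transformed into vector fields of class $C^1$. Here $w(\theta)\frac{d}{d\theta}$ is transformed into $\tilde w(\tilde\theta)\frac{d}{d\tilde\theta}$ with $\tilde w(f(\theta))=w(\theta)f'(\theta)$ (at the finitely many exceptional points $\tilde w$ is determined by continuity). Rotations of the circle are included among these transformations. Two realizations are equivalent if one can be transformed to the other by a composition of equivalence transformations. *)

(* Defs.v *)
From Stdlib Require Import Reals List Relations.
From Coquelicot Require Import Coquelicot.
Open Scope R_scope.

(* The circle is R modulo 2 PI; a vector field v(theta) d/dtheta is represented
   by its 2 PI-periodic coefficient v : R -> R, and a space of vector fields by
   a predicate on such coefficients. *)
Definition cong2pi (x y : R) : Prop := exists k : Z, y = x + 2 * PI * IZR k.

Definition periodic (v : R -> R) : Prop :=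
  forall t : R, v (t + 2 * PI) = v t.

Definition cont_diff_at (f : R -> R) (t : R) : Prop :=
  locally t (fun x => ex_derive f x) /\ continuous (Derive f) t.

Definition C1_field (v : R -> R) : Prop :=
  periodic v /\ forall t : R, cont_diff_at v t.

Definition singular_point (v : R -> R) (t : R) : Prop := v t = 0.

Definition class_C (v : R -> R) : Prop :=
  C1_field v /\
  forall a b : R, a < b -> ~ (forall t : R, a < t < b -> singular_point v t).

Definition bracket (v w : R -> R) : R -> R :=
  fun t => v t * Derive w t - Derive v t * w t.

Definition nonzero_field (v : R -> R) : Prop := exists t : R, v t <> 0.

Definition span2 (W V : R -> R) : (R -> R) -> Prop :=
  fun u => exists a b : R, forall t : R, u t = a * W t + b * V t.

Definition independent (W V : R -> R) : Prop :=
  forall a b : R, (forall t : R, a * W t + b * V t = 0) -> a = 0 /\ b = 0.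

Definition realization (A : (R -> R) -> Prop) : Prop :=
  (exists W V : R -> R,
     independent W V /\ forall u : R -> R, A u <-> span2 W V u) /\
  (forall u v : R -> R, A u -> A v -> A (bracket u v)) /\
  (exists u v : R -> R, A u /\ A v /\ nonzero_field (bracket u v)) /\
  (forall u : R -> R, A u -> nonzero_field u -> class_C u).

(* A continuous map of the circle is represented by a continuous lift
   F : R -> R (one exists for every continuous circle map, and its derivative
   does not depend on the choice of lift).  The two implications of the first
   clause say that F descends to the circle and that the induced map is
   injective; the second clause is surjectivity. *)
Definition circle_bijection (F : R -> R) : Prop :=
  (forall x y : R, cong2pi x y <-> cong2pi (F x) (F y)) /\
  (forall y : R, exists x : R, cong2pi (F x) y).

(* [is_lim] is the limit over a punctured neighbourhood; by the finiteness
   clause, F is differentiable in a punctured neighbourhood of each point. *)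
Definition circle_transformation (F : R -> R) : Prop :=
  circle_bijection F /\
  (forall t : R, continuous F t) /\
  (exists l : list R, forall t : R,
     ~ cont_diff_at F t -> exists p : R, In p l /\ cong2pi p t) /\
  (forall t : R, ~ cont_diff_at F t ->
     is_lim (Derive F) t p_infty \/ is_lim (Derive F) t m_infty).

(* The values of u at the images of the exceptional points of F are
   determined by the continuity of u. *)
Definition transformed (F w u : R -> R) : Prop :=
  C1_field w /\ C1_field u /\
  forall t : R, cont_diff_at F t -> u (F t) = w t * Derive F t.

Definition transformation_step (A B : (R -> R) -> Prop) : Prop :=
  exists F : R -> R,
    circle_transformation F /\
    (forall w : R -> R, A w -> exists u : R -> R, transformed F w u) /\
    (forall u : R -> R, B u <-> exists w : R -> R, A w /\ transformed F w u).

(* Transitive closure: composition of finitely many (at least one)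
   transformations; the identity map is itself a transformation. *)
Definition equivalent : ((R -> R) -> Prop) -> ((R -> R) -> Prop) -> Prop :=
  clos_trans ((R -> R) -> Prop) transformation_step.

(* All the functions sigma_k are packed into one periodic function s.  Its
   values at the multiples of 2 PI / n are immaterial, since 1 - cos (n t)
   vanishes there. *)
Definition sign_function (n : nat) (s : R -> R) : Prop :=
  periodic s /\
  forall k : nat, (k < n)%nat ->
    exists e : R, (e = 1 \/ e = -1) /\
      forall t : R,
        2 * PI * INR k / INR n < t < 2 * PI * INR (k + 1) / INR n -> s t = e.

(* Main.v *)
Require Import Defs.
From Stdlib Require Import Reals List Relations.
From Coquelicot Require Import Coquelicot.
From Stdlib Require Import Lra Lia ZArith Classical IndefiniteDescription.
Open Scope R_scope.

(** A realization has generators with [V, W] = W.  Where W has no zero, the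
    derivative of V / W is - 1 / W; hence W must vanish somewhere on the circle,
    its zeros are zeros of V, they are finitely many, and between consecutive
    zeros V / W runs monotonically from one infinity to the other.  The same holds
    for the normal form, where V / W is (up to sign) cot(n theta / 2) / n, so that
    a homeomorphism F matching the two ratios is determined: F' = 2|W| / (W^2 + n^2 V^2).
    Its behaviour at the zeros is controlled by the value of V' there: if V' = 0 at
    every zero, then F' tends to 0 at the zeros and F is of class C^1.  This is
    achieved beforehand by transformations whose derivative blows up like
    1 / (|t| log^2 |t|) at a zero: they turn any value of V' at that zero into 0. *)

(** The detour through V' = 0 answers an obstacle. Near a zero, F' behaves like a constant times |W|
    / V^2, whose logarithmic derivative is (1 - V') / V. If V' = 1 at the zero, as in the normal
    form, continuity of V' alone does not make (1 - V') / V integrable: F' may oscillate between two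
    positive values, and then F is neither continuously differentiable nor of infinite derivative
    there, hence not admissible. If V' = 0 at the zero, |W| / V^2 tends to 0 whatever the finer
    behaviour of V. The blow-up has to be logarithmic. A field w transported by F acquires the
    derivative w' + w F''/F'; at a zero placed at 0 its limit is w' times 1 + lim t F''/F'. The
    power |t|^p multiplies w' by p. The factor 0 is the borderline case F' = 1/|t|, which only the
    correction by log^2 |t| makes integrable. The infinite derivative at the zero is the one
    permitted by clause (iv). *)

(** * Limits, continuity and derivatives in epsilon form *)

Lemma locally_R (x : R) (P : R -> Prop) :
  locally x P <-> exists d, 0 < d /\ forall y, Rabs (y - x) < d -> P y.
Proof.
  split.
  - intros [d Hd]. exists d. split; [apply cond_pos | exact Hd].
  - intros (d & Hd & H). exists (mkposreal d Hd). exact H.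
Qed.

Lemma is_lim_R (f : R -> R) (x l : R) :
  is_lim f x l <-> forall e, 0 < e ->
    exists d, 0 < d /\ forall y, y <> x -> Rabs (y - x) < d -> Rabs (f y - l) < e.
Proof.
  rewrite <- is_lim_spec. split.
  - intros H e He. destruct (H (mkposreal e He)) as [d Hd].
    exists d. split; [apply cond_pos | intros y Hy Hb; exact (Hd y Hb Hy)].
  - intros H e. destruct (H e (cond_pos e)) as (d & Hd & H').
    exists (mkposreal d Hd). intros y Hb Hy. exact (H' y Hy Hb).
Qed.

Lemma continuous_R (f : R -> R) (x : R) :
  continuous f x <-> forall e, 0 < e ->
    exists d, 0 < d /\ forall y, Rabs (y - x) < d -> Rabs (f y - f x) < e.
Proof.
  unfold continuous. rewrite filterlim_locally. split.
  - intros H e He. apply locally_R. exact (H (mkposreal e He)).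
  - intros H e. apply locally_R. exact (H e (cond_pos e)).
Qed.

Lemma continuous_is_lim (f : R -> R) (x : R) : continuous f x <-> is_lim f x (f x).
Proof.
  rewrite continuous_R, is_lim_R. split; intros H e He;
    destruct (H e He) as (d & Hd & H'); exists d; split; auto.
  intros y Hy. destruct (Req_dec y x) as [->|Hn]; auto.
  rewrite Rminus_diag, Rabs_R0. exact He.
Qed.

Lemma continuous_pt (f : R -> R) (x : R) : continuous f x <-> continuity_pt f x.
Proof. rewrite continuity_pt_filterlim. reflexivity. Qed.

Lemma continuous_neq0_locally (f : R -> R) (x : R) :
  continuous f x -> f x <> 0 -> locally x (fun y => f y <> 0).
Proof.
  intros Hc Hx. apply locally_R.
  destruct (proj1 (continuous_R f x) Hc (Rabs (f x)) (Rabs_pos_lt _ Hx)) as (d & Hd & H).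
  exists d. split; auto. intros y Hy E. specialize (H y Hy). rewrite E in H.
  rewrite Rminus_0_l, Rabs_Ropp in H. lra.
Qed.

Lemma is_derive_slope (f : R -> R) (x l : R) :
  is_derive f x l <-> is_lim (fun y => (f y - f x) / (y - x)) x l.
Proof.
  rewrite is_derive_Reals, is_lim_R. unfold derivable_pt_lim. split.
  - intros H e He. destruct (H e He) as [d Hd]. exists d. split; [apply cond_pos|].
    intros y Hy Hb. specialize (Hd (y - x)).
    replace (x + (y - x)) with y in Hd by ring. apply Hd; auto; lra.
  - intros H e He. destruct (H e He) as (d & Hd & H'). exists (mkposreal d Hd).
    intros h Hh Hb. specialize (H' (x + h)).
    replace (x + h - x) with h in H' by ring. apply H'; auto; lra.
Qed.

Lemma is_derive_cont (f : R -> R) (x l : R) : is_derive f x l -> continuous f x.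
Proof. intros H. exact (ex_derive_continuous f x (ex_intro _ l H)). Qed.

Lemma MVT_R (f df : R -> R) (a b : R) :
  a < b -> (forall x, a < x < b -> is_derive f x (df x)) ->
  (forall x, a <= x <= b -> continuous f x) ->
  exists c, a < c < b /\ f b - f a = df c * (b - a).
Proof.
  intros Hab Hd Hc.
  assert (pr : forall c, a < c < b -> derivable_pt f c).
  { intros c H. exists (df c). apply is_derive_Reals. auto. }
  destruct (MVT f id a b pr (fun c _ => derivable_pt_id c) Hab) as (c & P & E).
  - intros c H. apply continuous_pt; auto.
  - intros c H. apply derivable_continuous_pt, derivable_pt_id.
  - exists c. split; auto.
    assert (E1 : derive_pt f c (pr c P) = df c).
    { apply derive_pt_eq_0. apply is_derive_Reals. auto. }
    rewrite E1 in E.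
    assert (E2 : derive_pt id c (derivable_pt_id c) = 1) by apply derive_pt_id.
    rewrite E2 in E. unfold id in E. lra.
Qed.

Lemma is_derive_of_lim (f df : R -> R) (x l : R) :
  continuous f x ->
  (exists d, 0 < d /\ forall y, y <> x -> Rabs (y - x) < d -> is_derive f y (df y)) ->
  is_lim df x l -> is_derive f x l.
Proof.
  intros Hc (d & Hd & Hf) Hl. apply is_derive_slope, is_lim_R. intros e He.
  destruct (proj1 (is_lim_R _ _ _) Hl e He) as (d' & Hd' & H).
  exists (Rmin d d'). split; [apply Rmin_pos; auto|].
  intros y Hy Hb.
  assert (Rabs (y - x) < d) by (eapply Rlt_le_trans; [exact Hb | apply Rmin_l]).
  assert (Rabs (y - x) < d') by (eapply Rlt_le_trans; [exact Hb | apply Rmin_r]).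
  clear Hb.
  assert (Hin : forall z, Rmin x y <= z <= Rmax x y -> z <> x ->
            Rabs (z - x) < d /\ Rabs (z - x) < d').
  { intros z Hz Hn. revert Hz. unfold Rmin, Rmax.
    destruct (Rle_dec x y); intros; split; revert H0 H1; unfold Rabs;
      repeat destruct Rcase_abs; lra. }
  assert (Hcz : forall z, Rmin x y <= z <= Rmax x y -> continuous f z).
  { intros z Hz. destruct (Req_dec z x) as [->|Hn]; auto.
    destruct (Hin z Hz Hn). eapply is_derive_cont; apply Hf; auto. }
  assert (exists c, Rmin x y <= c <= Rmax x y /\ c <> x /\ f y - f x = df c * (y - x))
    as (c & Hcb & Hcn & E).
  { destruct (Rtotal_order x y) as [Hlt|[Heq|Hgt]]; [|exfalso; auto|].
    - rewrite Rmin_left, Rmax_right in * by lra.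
      destruct (MVT_R f df x y Hlt) as (c & Hc1 & E).
      + intros z Hz. apply Hf; [lra|]. apply (Hin z); lra.
      + auto.
      + exists c. repeat split; auto; lra.
    - rewrite Rmin_right, Rmax_left in * by lra.
      destruct (MVT_R f df y x Hgt) as (c & Hc1 & E).
      + intros z Hz. apply Hf; [lra|]. apply (Hin z); lra.
      + auto.
      + exists c. repeat split; auto; lra. }
  rewrite E. replace (df c * (y - x) / (y - x)) with (df c) by (field; lra).
  apply H; auto. apply Hin; auto.
Qed.

Lemma decr_of_derive (f df : R -> R) (a b : R) :
  (forall x, a < x < b -> is_derive f x (df x)) ->
  (forall x, a < x < b -> df x <= 0) ->
  forall x y, a < x -> x <= y -> y < b -> f y <= f x.
Proof.
  intros Hd Hs x y Hx Hxy Hy. destruct (Req_dec x y) as [->|Hn]; [lra|].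
  destruct (MVT_R f df x y) as (c & Hc & E); [lra| | |].
  - intros z Hz. apply Hd. lra.
  - intros z Hz. eapply is_derive_cont. apply Hd. lra.
  - assert (df c <= 0) by (apply Hs; lra). nra.
Qed.

(** * Periodicity and circle maps *)

(** Lifts of degree one: all the transformations constructed below preserve the orientation. *)
Definition circle_lift (F : R -> R) : Prop := forall t, F (t + 2 * PI) = F t + 2 * PI.

Lemma two_PI_pos : 0 < 2 * PI.
Proof. generalize PI_RGT_0. lra. Qed.

Lemma periodic_Z (v : R -> R) (k : Z) (t : R) :
  periodic v -> v (t + 2 * PI * IZR k) = v t.
Proof.
  intros Hv.
  assert (Hn : forall (n : nat) u, v (u + 2 * PI * INR n) = v u).
  { induction n as [|n IH]; intros u.
    - simpl. f_equal. ring.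
    - rewrite S_INR. replace (u + 2 * PI * (INR n + 1)) with (u + 2 * PI * INR n + 2 * PI) by ring.
      rewrite Hv. apply IH. }
  destruct (Z_le_dec 0 k).
  - rewrite <- (Z2Nat.id k), <- INR_IZR_INZ by lia. apply Hn.
  - rewrite <- (Hn (Z.to_nat (- k)) (t + 2 * PI * IZR k)).
    rewrite INR_IZR_INZ, Z2Nat.id, opp_IZR by lia. f_equal. ring.
Qed.

Lemma circle_lift_Z (F : R -> R) (k : Z) (t : R) :
  circle_lift F -> F (t + 2 * PI * IZR k) = F t + 2 * PI * IZR k.
Proof.
  intros HF. assert (Hp : periodic (fun t => F t - t)).
  { intros u. rewrite HF. ring. }
  generalize (periodic_Z _ k t Hp). simpl. lra.
Qed.

Lemma shift_into (a t : R) : exists k : Z, a <= t + 2 * PI * IZR k < a + 2 * PI.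
Proof.
  generalize two_PI_pos; intros HP.
  destruct (archimed ((a - t) / (2 * PI))) as [H1 H2].
  set (m := up ((a - t) / (2 * PI))) in *.
  assert (E : a - t = 2 * PI * ((a - t) / (2 * PI))) by (field; lra).
  destruct (Rle_lt_dec (a + 2 * PI) (t + 2 * PI * IZR m)).
  - exists (m - 1)%Z. rewrite minus_IZR. nra.
  - exists m. nra.
Qed.

Lemma Derive_periodic (v : R -> R) : periodic v -> periodic (Derive v).
Proof.
  intros Hv t. unfold Derive. f_equal. apply Lim_ext. intros h. rewrite Hv.
  replace (t + 2 * PI + h) with (t + h + 2 * PI) by ring. rewrite Hv. reflexivity.
Qed.

Lemma C1_field_derive (v : R -> R) (t : R) : C1_field v -> is_derive v t (Derive v t).
Proof.
  intros [_ H]. destruct (H t) as [H1 _].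
  apply Derive_correct. apply (locally_singleton _ _ H1).
Qed.

Lemma C1_field_cont (v : R -> R) (t : R) : C1_field v -> continuous v t.
Proof. intros H. eapply is_derive_cont, C1_field_derive, H. Qed.

Lemma C1_field_cont_D (v : R -> R) (t : R) : C1_field v -> continuous (Derive v) t.
Proof. intros [_ H]. apply (H t). Qed.

Lemma cont_diff_of (f df : R -> R) (t : R) :
  locally t (fun x => is_derive f x (df x)) -> continuous df t -> cont_diff_at f t.
Proof.
  intros H Hc. split.
  - refine (filter_imp _ _ _ H). intros x Hx. exists (df x). exact Hx.
  - apply continuous_ext_loc with df; auto.
    refine (filter_imp _ _ _ H). intros x Hx. symmetry. apply is_derive_unique, Hx.
Qed.

Lemma C1_field_of (v dv : R -> R) :
  periodic v -> (forall t, is_derive v t (dv t)) -> (forall t, continuous dv t) -> C1_field v.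
Proof.
  intros Hp Hd Hc. split; auto. intros t. apply cont_diff_of with dv; auto.
  apply filter_forall, Hd.
Qed.

Lemma lift_bijective (F : R -> R) :
  circle_lift F -> (forall x y, x < y -> F x < F y) -> (forall t, continuous F t) ->
  circle_bijection F /\ exists K : R -> R,
    (forall y, F (K y) = y) /\ (forall x, K (F x) = x) /\ (forall t, continuous K t).
Proof.
  intros HL Hi Hc. generalize two_PI_pos; intros HP.
  assert (Hinj : forall x y, F x = F y -> x = y).
  { intros x y E. destruct (Rtotal_order x y) as [H|[H|H]]; auto; apply Hi in H; lra. }
  assert (Hs : forall y, exists x, F x = y).
  { intros y. destruct (shift_into (F 0) y) as [k [H1 H2]].
    replace (F 0 + 2 * PI) with (F (0 + 2 * PI)) in H2 by apply HL.
    destruct (IVT_gen F 0 (0 + 2 * PI) (y + 2 * PI * IZR k)) as (x & _ & E).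
    - intros t. apply continuous_pt, Hc.
    - split; [eapply Rle_trans; [apply Rmin_l|]; lra |
        eapply Rle_trans; [|apply Rmax_r]; lra].
    - exists (x + 2 * PI * IZR (- k)). rewrite circle_lift_Z, E, opp_IZR by auto. ring. }
  split; [split|].
  - intros x y. split; intros [k E]; exists k.
    + rewrite E. apply circle_lift_Z; auto.
    + apply Hinj. rewrite E, circle_lift_Z; auto.
  - intros y. destruct (Hs y) as [x E]. exists x. exists 0%Z. rewrite E. ring.
  - destruct (functional_choice _ Hs) as [K HK]. exists K.
    assert (HK2 : forall x, K (F x) = x) by (intros x; apply Hinj, HK).
    split; [exact HK|split; [exact HK2|]].
    intros s. apply continuous_R. intros e He.
    set (t := K s). assert (Es : F t = s) by apply HK.
    assert (F (t - e) < F t < F (t + e)) by (split; apply Hi; lra).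
    exists (Rmin (F t - F (t - e)) (F (t + e) - F t)).
    split; [apply Rmin_pos; lra|]. intros y Hy.
    assert (H1 : Rabs (y - s) < F t - F (t - e)) by (eapply Rlt_le_trans; [exact Hy|apply Rmin_l]).
    assert (H2 : Rabs (y - s) < F (t + e) - F t) by (eapply Rlt_le_trans; [exact Hy|apply Rmin_r]).
    apply Rabs_def2 in H1. apply Rabs_def2 in H2.
    rewrite <- (HK y) in H1, H2. fold t. apply Rabs_def1.
    + destruct (Rlt_le_dec (K y) (t + e)) as [|[H'|H']];
        [lra| |].
      * apply Hi in H'. lra.
      * rewrite <- H' in H2. lra.
    + destruct (Rlt_le_dec (t - e) (K y)) as [|[H'|H']];
        [lra| |].
      * apply Hi in H'. lra.
      * rewrite H' in H1. lra.
Qed.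

Lemma is_derive_inverse (F K : R -> R) (s d : R) :
  (forall y, F (K y) = y) -> continuous K s -> is_derive F (K s) d -> d <> 0 ->
  is_derive K s (/ d).
Proof.
  intros HFK Hc Hd Hn.
  assert (Hinj : forall x y, K x = K y -> x = y)
    by (intros x y E; rewrite <- (HFK x), <- (HFK y), E; auto).
  apply is_derive_slope. apply is_derive_slope in Hd.
  assert (H : is_lim (fun y => / ((F (K y) - F (K s)) / (K y - K s))) s (/ d)).
  { apply (is_lim_inv (fun y => (F (K y) - F (K s)) / (K y - K s)) s d).
    - apply is_lim_comp with (f := fun x => (F x - F (K s)) / (x - K s)) (l := K s).
      + exact Hd.
      + apply continuous_is_lim, Hc.
      + exists (mkposreal 1 Rlt_0_1). intros y _ Hy E. injection E as E. auto.
    - intros E. injection E. exact Hn. }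
  apply is_lim_R. intros e He. destruct (proj1 (is_lim_R _ _ _) H e He) as (r & Hr & H').
  exists r. split; auto. intros y Hy Hb. specialize (H' y Hy Hb).
  rewrite !HFK in H'. replace ((K y - K s) / (y - s)) with (/ ((y - s) / (K y - K s))); auto.
  assert (K y - K s <> 0) by (intros E; apply Hy, Hinj; lra).
  assert (y - s <> 0) by lra. field. split; assumption.
Qed.

(** * Pairs of fields with [V, W] = W *)

Definition affine_pair (W V : R -> R) : Prop :=
  C1_field W /\ C1_field V /\ (forall t, bracket V W t = W t) /\
  (forall a b, a < b -> ~ (forall t, a < t < b -> W t = 0)).

Lemma is_derive_square (f : R -> R) (x d : R) :
  is_derive f x d -> is_derive (fun t => f t * f t) x (2 * f x * d).
Proof.
  intros H. replace (2 * f x * d) with (d * f x + f x * d) by ring.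
  apply (is_derive_mult f f x d d H H). intros; apply Rmult_comm.
Qed.

(** If V a is not 0, the relation reads W' = c W near a with [c] continuous, hence bounded above by
    [M]. Gronwall: W^2 exp(-2 M t) does not increase there, and it is 0 at [a], so W would vanish on
    an interval to the right of [a]. *)
Lemma pair_zero (W V : R -> R) (a : R) : affine_pair W V -> W a = 0 -> V a = 0.
Proof.
  intros (HW & HV & Hb & Hn) Ha. apply NNPP. intros HVa.
  set (c := fun t => (1 + Derive V t) / V t).
  assert (Hc : continuous c a).
  { unfold c, Rdiv. apply (continuous_mult (fun t => 1 + Derive V t) (fun t => / V t)).
    - apply (continuous_plus (fun _ => 1) (Derive V)); [apply continuous_const|].
      apply C1_field_cont_D, HV.
    - apply continuous_Rinv_comp; auto. apply C1_field_cont, HV. }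
  destruct (proj1 (continuous_R _ _) Hc 1 Rlt_0_1) as (d1 & Hd1 & H1).
  destruct (proj1 (locally_R _ _) (continuous_neq0_locally V a (C1_field_cont V a HV) HVa))
    as (d2 & Hd2 & H2).
  set (d := Rmin d1 d2). assert (Hd : 0 < d) by (apply Rmin_pos; auto).
  set (M := c a + 1).
  assert (Hder : forall t, is_derive (fun t => W t ^ 2 * exp (- 2 * M * t)) t
            (2 * W t * (Derive W t - M * W t) * exp (- 2 * M * t))).
  { intros t. generalize (C1_field_derive W t HW); intros E.
    auto_derive; [exists (Derive W t); exact E|].
    change (Derive (fun x => W x)) with (Derive W). ring. }
  apply (Hn a (a + d)); [lra|]. intros t Ht.
  assert (H : (fun t => W t ^ 2 * exp (- 2 * M * t)) t <=
              (fun t => W t ^ 2 * exp (- 2 * M * t)) a).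
  { apply (decr_of_derive _ _ (a - d) (a + d) (fun x _ => Hder x)); try lra.
    intros x Hx. assert (Hxd : Rabs (x - a) < d) by (apply Rabs_def1; lra).
    assert (Hx1 : Rabs (x - a) < d1) by (eapply Rlt_le_trans; [exact Hxd|apply Rmin_l]).
    assert (Hx2 : Rabs (x - a) < d2) by (eapply Rlt_le_trans; [exact Hxd|apply Rmin_r]).
    apply H1 in Hx1. apply Rabs_def2 in Hx1. apply H2 in Hx2.
    assert (E : Derive W x = c x * W x).
    { generalize (Hb x). unfold bracket, c. intros E.
      replace (Derive W x) with ((V x * Derive W x) / V x) by (field; auto).
      replace (V x * Derive W x) with (W x + Derive V x * W x) by lra. field; auto. }
    rewrite E. generalize (exp_pos (- 2 * M * x)); intros He.
    replace (2 * W x * (c x * W x - M * W x)) with (- (2 * (W x * W x) * (M - c x))) by ring.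
    assert (0 <= W x * W x * (M - c x)).
    { apply Rmult_le_pos; [apply Rle_0_sqr|unfold M; lra]. }
    nra. }
  simpl in H. rewrite Ha in H. generalize (exp_pos (- 2 * M * t)); intros He.
  assert (W t * W t <= 0) by nra. nra.
Qed.

Lemma pair_has_zero (W V : R -> R) : affine_pair W V -> exists a, W a = 0.
Proof.
  intros (HW & HV & Hb & Hn). apply NNPP. intros H.
  assert (Hnz : forall t, W t <> 0) by (intros t E; apply H; exists t; exact E).
  assert (Hd : forall t, is_derive (fun t => V t / W t) t (- / W t)).
  { intros t. generalize (C1_field_derive W t HW) (C1_field_derive V t HV); intros E1 E2.
    evar_last; [apply is_derive_div; eauto|]. generalize (Hb t). unfold bracket. intros E.
    replace (Derive V t * W t - V t * Derive W t) with (- W t) by lra. field. auto. }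
  destruct (MVT_R _ _ 0 (0 + 2 * PI) ltac:(generalize PI_RGT_0; lra) (fun x _ => Hd x))
    as (c & _ & E).
  - intros x _. eapply is_derive_cont, Hd.
  - destruct HW as [HW _], HV as [HV _]. rewrite HW, HV in E.
    generalize (Rinv_neq_0_compat _ (Hnz c)) PI_RGT_0. intros. nra.
Qed.

(* At an interior extremum of W the relation gives V' = -1, whereas V' vanishes
   somewhere between two zeros of V. *)
Lemma pair_zeros_separated (W V : R -> R) : affine_pair W V ->
  exists d, 0 < d /\ forall a b, a < b -> W a = 0 -> W b = 0 -> d <= b - a.
Proof.
  intros HP. generalize HP; intros (HW & HV & Hb & Hn).
  (* The extra length 1 is room for [b]: [a] is moved into [0, 2 PI), and only b - a < 1 has to be
     excluded. *)
  destruct (unifcont_1d (Derive V) 0 (2 * PI + 1) (fun x _ => C1_field_cont_D V x HV)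
              (mkposreal 1 Rlt_0_1)) as [d Hd].
  exists (Rmin d 1). split; [apply Rmin_pos; [apply cond_pos|lra]|].
  intros a0 b0 Hab0 Ha0 Hb0.
  destruct (shift_into 0 a0) as [k Hk].
  set (a := a0 + 2 * PI * IZR k) in *. set (b := b0 + 2 * PI * IZR k).
  assert (Ha : W a = 0) by (unfold a; rewrite periodic_Z; auto; apply HW).
  assert (Hb' : W b = 0) by (unfold b; rewrite periodic_Z; auto; apply HW).
  replace (b0 - a0) with (b - a) by (unfold a, b; ring).
  assert (Hab : a < b) by (unfold a, b; lra).
  clearbody a b. clear a0 b0 Hab0 Ha0 Hb0.
  apply Rnot_lt_le. intros Hlt.
  assert (Hl1 : b - a < d) by (eapply Rlt_le_trans; [exact Hlt|apply Rmin_l]).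
  assert (Hl2 : b - a < 1) by (eapply Rlt_le_trans; [exact Hlt|apply Rmin_r]).
  destruct (MVT_R V (Derive V) a b Hab (fun x _ => C1_field_derive V x HV)
     (fun x _ => C1_field_cont V x HV)) as (e & He & Ee).
  rewrite (pair_zero W V a HP Ha), (pair_zero W V b HP Hb') in Ee.
  assert (Ee' : Derive V e = 0) by nra.
  (* Maximizing W^2 instead of W treats both signs of W at once. *)
  destruct (continuity_ab_maj (fun t => W t * W t) a b (Rlt_le _ _ Hab)) as (c & Hc & Hcab).
  { intros t _. apply continuous_pt.
    apply (continuous_mult W W); apply C1_field_cont, HW. }
  assert (HWc : W c <> 0).
  { intros E. apply (Hn a b Hab). intros t Ht. specialize (Hc t). simpl in Hc.
    rewrite E in Hc. assert (W t * W t <= 0) by (specialize (Hc ltac:(lra)); lra). nra. }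
  assert (Hci : a < c < b).
  { split; apply Rnot_le_lt; intros Hle; apply HWc.
    - replace c with a by lra. auto.
    - replace c with b by lra. auto. }
  assert (E1 : Derive W c = 0).
  { assert (pr : derivable_pt (fun t => W t * W t) c).
    { exists (2 * W c * Derive W c). apply is_derive_Reals.
      apply is_derive_square, C1_field_derive, HW. }
    assert (E : derive_pt _ c pr = 0).
    { apply (deriv_maximum _ a b c pr); try lra. intros; apply Hc; lra. }
    rewrite Derive_Reals in E.
    assert (E' : Derive (fun t => W t * W t) c = 2 * W c * Derive W c).
    { apply is_derive_unique.
      apply is_derive_square, C1_field_derive, HW. }
    rewrite E' in E. apply Rmult_integral in E. destruct E; auto. exfalso. nra. }
  assert (E2 : Derive V c = -1).
  { generalize (Hb c). unfold bracket. rewrite E1. intros E.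
    apply (Rmult_eq_reg_r (W c)); auto. lra. }
  apply (Hd e c); [lra|lra| |].
  - apply Rabs_def1; unfold minus, plus, opp; simpl; lra.
  - intros HB. rewrite Ee', E2 in HB. revert HB. unfold ball; simpl. unfold AbsRing_ball, abs, minus, plus, opp; simpl.
    unfold Rabs. destruct Rcase_abs; lra.
Qed.

(** The zeros of one period in increasing order. [z 0] and [z n] are the same point of the circle,
    so [n] counts the zeros on the circle; it becomes the [n] of the normal form. *)
Definition zero_chain (W : R -> R) (n : nat) (z : nat -> R) : Prop :=
  (1 <= n)%nat /\ z n = z 0%nat + 2 * PI /\
  (forall k, (k <= n)%nat -> W (z k) = 0) /\
  forall k, (k < n)%nat -> z k < z (S k) /\ forall t, z k < t < z (S k) -> W t <> 0.

Lemma pair_next_zero (W V : R -> R) (a b : R) : affine_pair W V ->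
  a < b -> W a = 0 -> W b = 0 ->
  exists m, a < m <= b /\ W m = 0 /\ forall t, a < t < m -> W t <> 0.
Proof.
  intros HP Hab Ha Hb. destruct (pair_zeros_separated W V HP) as (d & Hd & Hs).
  destruct HP as (HW & _).
  (* The next zero is the infimum of the zeros beyond [a], obtained as a supremum of opposites. The
     separation constant keeps it away from [a]. *)
  destruct (completeness (fun x => a < - x /\ W (- x) = 0)) as [l [Hl1 Hl2]].
  - exists (- a). intros x [Hx _]. lra.
  - exists (- b). rewrite Ropp_involutive. auto.
  - assert (Hlb : - b <= l) by (apply Hl1; rewrite Ropp_involutive; auto).
    assert (Hla : l <= - (a + d)).
    { apply Hl2. intros x [Hx1 Hx2]. specialize (Hs _ _ Hx1 Ha Hx2). lra. }
    exists (- l). split; [lra|split].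
    + apply NNPP. intros Hn.
      destruct (proj1 (locally_R _ _) (continuous_neq0_locally W _ (C1_field_cont W _ HW) Hn))
        as (e & He & H).
      assert (l <= l - Rmin e d).
      { apply Hl2. intros x [Hx1 Hx2].
        assert (x <= l) by (apply Hl1; auto).
        destruct (Rle_lt_dec x (l - e)) as [|Hlt];
          [generalize (Rmin_l e d); lra|].
        exfalso. apply (H (- x)); auto. apply Rabs_def1; lra. }
      generalize (Rmin_pos e d He Hd). lra.
    + intros t Ht E. assert (- t <= l) by (apply Hl1; rewrite Ropp_involutive; split; [lra|auto]).
      lra.
Qed.

(** From one zero [a], pass repeatedly to the next zero. Each move advances by at least the
    separation constant and none goes beyond the zero a + 2 PI, so this point is reached after
    finitely many moves. *)
Lemma pair_zero_chain (W V : R -> R) : affine_pair W V -> exists n z, zero_chain W n z.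
Proof.
  intros HP. destruct (pair_has_zero W V HP) as [a Ha].
  destruct (pair_zeros_separated W V HP) as (d & Hd & Hs).
  set (b := a + 2 * PI).
  assert (Hb : W b = 0).
  { unfold b. destruct HP as ((Hper & _) & _). rewrite Hper. auto. }
  set (good := fun m (z : nat -> R) => z 0%nat = a /\ W (z m) = 0 /\
    forall k, (k < m)%nat -> W (z k) = 0 /\ z k < z (S k) /\ forall t, z k < t < z (S k) -> W t <> 0).
  (* Either the period has been closed, or [m] moves are still short of [b]; the bound by
     [INR m * d] refutes the second case for large [m]. *)
  assert (H : forall m, (exists n z, zero_chain W n z) \/
     exists z, good m z /\ a + INR m * d <= z m < b).
  { induction m as [|m [IH|(z & (H0 & Hm & Hk) & Hz)]].
    - right. exists (fun _ => a). repeat split; auto; try lia.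
      + simpl. lra.
      + unfold b. generalize PI_RGT_0. lra.
    - left; auto.
    - destruct (pair_next_zero W V (z m) b HP) as (x & Hx & HWx & Hgap); try tauto.
      set (z' := fun k => if Nat.eq_dec k (S m) then x else z k).
      assert (Ez : forall k, (k <= m)%nat -> z' k = z k).
      { intros k Hle. unfold z'. destruct Nat.eq_dec; [lia|auto]. }
      assert (Ex : z' (S m) = x) by (unfold z'; destruct Nat.eq_dec; [auto|lia]).
      assert (Hg : good (S m) z').
      { split; [rewrite Ez by lia; auto|]. split; [rewrite Ex; auto|].
        intros k Hlt. destruct (Nat.eq_dec k m) as [->|Hne].
        - rewrite Ex, Ez by lia. repeat split; auto; lra.
        - rewrite !Ez by lia. apply Hk. lia. }
      destruct (Req_dec x b) as [->|Hxb].
      + left. exists (S m), z'. destruct Hg as (Hg0 & Hg1 & Hg2).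
        split; [lia|]. split; [rewrite Ex, Hg0; auto|]. split.
        * intros k Hle. destruct (Nat.eq_dec k (S m)) as [->|]; auto. apply Hg2. lia.
        * intros k Hlt. apply Hg2; auto.
      + right. exists z'. split; auto. rewrite Ex, S_INR.
        specialize (Hs (z m) x ltac:(lra) Hm HWx). lra. }
  destruct (INR_unbounded ((b - a) / d)) as [m Hm].
  destruct (H m) as [|(z & _ & Hz)]; auto. exfalso.
  assert (b - a < INR m * d).
  { replace (b - a) with ((b - a) / d * d) by (field; lra). apply Rmult_lt_compat_r; auto. }
  lra.
Qed.

Lemma pair_zeros_isolated (W V : R -> R) (a : R) : affine_pair W V -> W a = 0 ->
  exists d, 0 < d /\ forall t, t <> a -> Rabs (t - a) < d -> W t <> 0.
Proof.
  intros HP Ha. destruct (pair_zeros_separated W V HP) as (d & Hd & Hs).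
  exists d. split; auto. intros t Hn Ht E. apply Rabs_def2 in Ht.
  destruct (Rtotal_order a t) as [H|[H|H]]; [|auto|].
  - specialize (Hs a t H Ha E). lra.
  - specialize (Hs t a H E Ha). lra.
Qed.

Lemma zero_chain_locate (W : R -> R) (n : nat) (z : nat -> R) (t : R) :
  zero_chain W n z -> z 0%nat <= t < z n -> exists k, (k < n)%nat /\ z k <= t < z (S k).
Proof.
  intros (_ & _ & _ & H) Ht. assert (Hk : forall k, (k <= n)%nat -> t < z k ->
    exists j, (j < k)%nat /\ z j <= t < z (S j)).
  { induction k as [|k IH]; intros Hle Hlt; [lra|].
    destruct (Rle_lt_dec (z k) t).
    - exists k. auto.
    - destruct IH as (j & Hj & Hz); [lia|auto|]. exists j. split; auto. }
  apply Hk; [lia|lra].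
Qed.

Lemma zero_chain_zero (W : R -> R) (n : nat) (z : nat -> R) (t : R) :
  periodic W -> zero_chain W n z -> W t = 0 -> exists k, (k < n)%nat /\ cong2pi t (z k).
Proof.
  intros Hp Hz Ht. destruct (shift_into (z 0%nat) t) as [i Hi].
  assert (E : z n = z 0%nat + 2 * PI) by apply Hz.
  destruct (zero_chain_locate W n z (t + 2 * PI * IZR i) Hz) as (k & Hk & H); [lra|].
  exists k. split; auto. exists i.
  destruct (Req_dec (z k) (t + 2 * PI * IZR i)) as [|Hn]; auto.
  exfalso. destruct Hz as (_ & _ & _ & Hz). apply (Hz k Hk) with (t + 2 * PI * IZR i); [lra|].
  rewrite periodic_Z; auto.
Qed.

(** * Transport of fields *)

Lemma is_lim_locally' (f g : R -> R) (x : R) (l : Rbar) d :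
  0 < d -> (forall y, y <> x -> Rabs (y - x) < d -> f y = g y) ->
  is_lim f x l -> is_lim g x l.
Proof.
  intros Hd H. apply is_lim_ext_loc. exists (mkposreal d Hd). intros y Hy Hn. apply H; auto.
Qed.

(** Differentiating u(F t) = w(t) F'(t) gives u'(F t) = w' + w F''/F', which is [om] at regular
    points. At a bad point [w] vanishes, so the value of [F1] there is immaterial; the two limits 0
    make [u] and its derivative extend continuously, and [is_derive_of_lim] turns this into
    differentiability. *)
Lemma push_field (F F1 F2 K w om : R -> R) (bad : R -> Prop) :
  circle_lift F -> (forall s, F (K s) = s) -> (forall t, K (F t) = t) ->
  (forall s, continuous K s) -> C1_field w -> periodic F1 ->
  (forall t, exists d, 0 < d /\ forall y, y <> t -> Rabs (y - t) < d -> ~ bad y) ->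
  (forall t, ~ bad t -> is_derive F t (F1 t) /\ is_derive F1 t (F2 t) /\
     continuous F2 t /\ F1 t <> 0 /\ om t = Derive w t + w t * (F2 t / F1 t)) ->
  (forall t, bad t -> w t = 0 /\ om t = 0 /\ is_lim (fun x => w x * F1 x) t 0 /\
     is_lim (fun x => Derive w x + w x * (F2 x / F1 x)) t 0) ->
  C1_field (fun s => w (K s) * F1 (K s)) /\
  forall t, Derive (fun s => w (K s) * F1 (K s)) (F t) = om t.
Proof.
  intros HL HFK HKF HK Hw HF1 Hiso Hgood Hbad.
  set (u := fun s => w (K s) * F1 (K s)).
  assert (Hloc : forall t, ~ bad t -> locally t (fun y => ~ bad y)).
  { intros t Ht. apply locally_R. destruct (Hiso t) as (d & Hd & H). exists d. split; auto.
    intros y Hy. destruct (Req_dec y t) as [->|Hn]; auto. }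
  assert (Hom : forall t, continuous om t).
  { intros t. destruct (classic (bad t)) as [Hb|Hb].
    - destruct (Hbad t Hb) as (_ & E & _ & H). apply continuous_is_lim. rewrite E.
      destruct (Hiso t) as (d & Hd & Hi). refine (is_lim_locally' _ _ _ _ d Hd _ H).
      intros y Hn Hy. symmetry. apply Hgood. apply Hi; auto.
    - destruct (Hgood t Hb) as (H1 & H2 & H3 & H4 & E).
      apply continuous_ext_loc with (fun t => Derive w t + w t * (F2 t * / F1 t)).
      + refine (filter_imp _ _ _ (Hloc t Hb)). intros y Hy. symmetry. apply Hgood, Hy.
      + apply (continuous_plus (Derive w) (fun t => w t * (F2 t * / F1 t))).
        * apply C1_field_cont_D, Hw.
        * apply (continuous_mult w (fun t => F2 t * / F1 t)); [apply C1_field_cont, Hw|].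
          apply (continuous_mult F2 (fun t => / F1 t)); auto.
          apply continuous_Rinv_comp; auto. eapply is_derive_cont, H2. }
  assert (HomK : forall s, continuous (fun s => om (K s)) s).
  { intros s. apply continuous_comp; [apply HK|apply Hom]. }
  assert (Hgd : forall s, ~ bad (K s) -> is_derive u s (om (K s))).
  { intros s Hb. destruct (Hgood _ Hb) as (H1 & H2 & H3 & H4 & E).
    assert (HKd := is_derive_inverse F K s (F1 (K s)) HFK (HK s) H1 H4).
    assert (Hx : is_derive (fun x => w x * F1 x) (K s)
              (Derive w (K s) * F1 (K s) + w (K s) * F2 (K s))).
    { apply (is_derive_mult w F1); auto.
      - apply C1_field_derive, Hw.
      - intros; apply Rmult_comm. }
    unfold u.
    evar_last; [apply (is_derive_comp (fun x => w x * F1 x) K s); [exact Hx|exact HKd]|].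
    unfold scal; simpl; unfold mult; simpl. rewrite E. field. auto. }
  assert (Hall : forall s, is_derive u s (om (K s))).
  { intros s. destruct (classic (bad (K s))) as [Hb|Hb]; auto.
    destruct (Hbad _ Hb) as (E0 & E & Hl & _).
    apply (is_derive_of_lim u (fun s => om (K s))).
    - unfold u. apply (continuous_comp K (fun x => w x * F1 x)); [apply HK|].
      apply continuous_is_lim. rewrite E0, Rmult_0_l. exact Hl.
    - destruct (Hiso (K s)) as (d & Hd & Hi).
      destruct (proj1 (continuous_R _ _) (HK s) d Hd) as (r & Hr & H).
      exists r. split; auto. intros y Hn Hy. apply Hgd, Hi; [|apply H, Hy].
      intros EK. apply Hn. rewrite <- (HFK y), <- (HFK s), EK. auto.
    - exact (proj1 (continuous_is_lim _ _) (HomK s)). }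
  split.
  - apply C1_field_of with (fun s => om (K s)); auto.
    intros s. assert (EK : K (s + 2 * PI) = K s + 2 * PI).
    { rewrite <- (HKF (K s + 2 * PI)), HL, HFK. auto. }
    unfold u. rewrite EK, HF1. destruct Hw as [Hw _]. rewrite Hw. auto.
  - intros t. rewrite (is_derive_unique _ _ _ (Hall (F t))), HKF. auto.
Qed.

Lemma eq_of_punctured (u v : R -> R) (s d : R) :
  continuous u s -> continuous v s -> 0 < d ->
  (forall y, y <> s -> Rabs (y - s) < d -> u y = v y) -> u s = v s.
Proof.
  intros Hu Hv Hd H. apply continuous_is_lim in Hu. apply continuous_is_lim in Hv.
  apply (is_lim_locally' _ _ _ _ d Hd H) in Hu.
  apply is_lim_unique in Hu. apply is_lim_unique in Hv. rewrite Hu in Hv.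
  injection Hv. auto.
Qed.

Lemma C1_field_lin (W V u : R -> R) (a b : R) : C1_field W -> C1_field V ->
  (forall t, u t = a * W t + b * V t) ->
  C1_field u /\ forall t, Derive u t = a * Derive W t + b * Derive V t.
Proof.
  intros HW HV Hu.
  assert (Hd : forall t, is_derive u t (a * Derive W t + b * Derive V t)).
  { intros t. apply is_derive_ext with (fun t => a * W t + b * V t); [intros; auto|].
    apply (is_derive_plus (fun t => a * W t) (fun t => b * V t));
      apply is_derive_scal; apply C1_field_derive; auto. }
  split.
  - apply C1_field_of with (fun t => a * Derive W t + b * Derive V t); auto.
    + intros t. rewrite !Hu. destruct HW as [HW _], HV as [HV _]. rewrite HW, HV. auto.
    + intros t. apply (continuous_plus (fun t => a * Derive W t) (fun t => b * Derive V t));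
        apply (continuous_scal_r (V := R_NormedModule)); apply C1_field_cont_D; auto.
  - intros t. apply is_derive_unique, Hd.
Qed.

(** It suffices to transport two generators. Conversely, a transform [u] of a combination is
    prescribed only at images of regular points; every point has a punctured neighbourhood of such
    images, so continuity forces [u] to be the same combination of [W1] and [V1]. *)
Lemma step_span (A : (R -> R) -> Prop) (F W V W1 V1 : R -> R) :
  circle_transformation F -> (forall u, A u <-> span2 W V u) ->
  C1_field W -> C1_field V -> C1_field W1 -> C1_field V1 ->
  (forall t, cont_diff_at F t -> W1 (F t) = W t * Derive F t /\ V1 (F t) = V t * Derive F t) ->
  (forall s, exists d, 0 < d /\ forall y, y <> s -> Rabs (y - s) < d ->
     exists t, cont_diff_at F t /\ F t = y) ->
  transformation_step A (span2 W1 V1).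
Proof.
  intros HF HA HW HV HW1 HV1 HE Hd.
  assert (Htr : forall a b u w, (forall t, u t = a * W1 t + b * V1 t) ->
     (forall t, w t = a * W t + b * V t) -> transformed F w u).
  { intros a b u w Hu Hw. split; [|split].
    - apply (C1_field_lin W V w a b); auto.
    - apply (C1_field_lin W1 V1 u a b); auto.
    - intros t Ht. destruct (HE t Ht) as [E1 E2]. rewrite Hu, Hw, E1, E2. ring. }
  exists F. split; [exact HF|split].
  - intros w Hw. apply HA in Hw. destruct Hw as (a & b & Hw).
    exists (fun t => a * W1 t + b * V1 t). apply (Htr a b); auto.
  - intros u. split.
    + intros (a & b & Hu). exists (fun t => a * W t + b * V t). split.
      * apply HA. exists a, b. auto.
      * apply (Htr a b); auto.
    + intros (w & Hw & (_ & HC & Ht)). apply HA in Hw. destruct Hw as (a & b & Hw).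
      exists a, b.
      destruct (C1_field_lin W1 V1 (fun s => a * W1 s + b * V1 s) a b HW1 HV1) as [HC' _]; auto.
      intros s. destruct (Hd s) as (d & Hdp & H).
      apply (eq_of_punctured u (fun s => a * W1 s + b * V1 s) s d); auto.
      * apply C1_field_cont; auto.
      * apply C1_field_cont; auto.
      * intros y Hn Hy. destruct (H y Hn Hy) as (t & Hc & <-).
        destruct (HE t Hc) as [E1 E2]. rewrite Ht, Hw, E1, E2 by auto. ring.
Qed.

(** * The logarithmic blow-up map *)

(** This is |sin (t/2)|, a periodic substitute for |t|/2 with a corner exactly at the multiples of 2
    PI, the nodes. *)
Definition half_sin (t : R) : R := sqrt ((1 - cos t) / 2).

(** The summand 1 keeps the value at least 1 on (0, 1], including q = 1 opposite the node, where the
    logarithm vanishes. *)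
Definition log_gap (q : R) : R := 1 - ln q.

(* Near 0 this behaves like t + sign(t) / log(1/|t|). *)
Definition blow (t : R) : R := t + sin t / (2 * half_sin t * log_gap (half_sin t)).

(** The derivative of [blow] in terms of q = [half_sin t], with leading part 1 / (2 q L^2), L being
    [log_gap q]. Only q occurs, since cos t and sin^2 t are polynomials in q^2. [blow2] is its
    derivative in q. *)
Definition blow1 (q : R) : R :=
  1 + ((1 - q * q) - q * q * log_gap q) / (2 * q * log_gap q ^ 2).

Definition blow2 (q : R) : R :=
  (- 1 + 2 / log_gap q - q * q * (2 + 2 / log_gap q + log_gap q)) / (2 * q ^ 2 * log_gap q ^ 2).

Lemma half_sin_sqr t : half_sin t * half_sin t = (1 - cos t) / 2.
Proof. apply sqrt_sqrt. generalize (COS_bound t). lra. Qed.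

Lemma half_sin_ge0 t : 0 <= half_sin t.
Proof. apply sqrt_pos. Qed.

Lemma half_sin_le1 t : half_sin t <= 1.
Proof.
  generalize (half_sin_sqr t) (half_sin_ge0 t) (COS_bound t). intros. nra.
Qed.

Lemma half_sin_periodic : periodic half_sin.
Proof. intros t. unfold half_sin. rewrite cos_plus, cos_2PI, sin_2PI. f_equal. lra. Qed.

Lemma half_sin_cont t : continuous half_sin t.
Proof.
  unfold half_sin. apply continuous_sqrt_comp.
  apply (continuous_mult (fun t => 1 - cos t) (fun _ => / 2)); [|apply continuous_const].
  apply (continuous_minus (fun _ => 1) cos); [apply continuous_const|].
  apply continuous_cos.
Qed.

Lemma half_sin_abs t : half_sin t = Rabs (sin (t / 2)).
Proof.
  unfold half_sin. rewrite <- sqrt_Rsqr_abs. f_equal.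
  replace t with (2 * (t / 2)) at 1 by field. rewrite cos_2a_sin. unfold Rsqr. field.
Qed.

Lemma half_sin_zero t : half_sin t = 0 -> cong2pi 0 t.
Proof.
  rewrite half_sin_abs. intros E. apply NNPP. intros Hn.
  assert (E' : sin (t / 2) = 0).
  { apply NNPP. intros H. apply (Rabs_no_R0 _ H E). }
  apply sin_eq_0_0 in E'. destruct E' as [k Hk]. apply Hn. exists k. lra.
Qed.

Lemma half_sin_0 (k : Z) : half_sin (2 * PI * IZR k) = 0.
Proof.
  replace (2 * PI * IZR k) with (0 + 2 * PI * IZR k) by ring.
  rewrite periodic_Z by apply half_sin_periodic.
  unfold half_sin. rewrite cos_0, Rminus_diag, Rdiv_0_l. apply sqrt_0.
Qed.

Lemma sin_half_sin t : sin t * sin t = 4 * (half_sin t * half_sin t) * (1 - half_sin t * half_sin t).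
Proof.
  rewrite half_sin_sqr. generalize (sin2_cos2 t). unfold Rsqr. intros. nra.
Qed.

Lemma is_derive_half_sin t : half_sin t <> 0 ->
  is_derive half_sin t (sin t / (4 * half_sin t)).
Proof.
  intros Hn. generalize (half_sin_ge0 t); intros H0.
  unfold half_sin. auto_derive.
  - generalize (half_sin_sqr t). intros. nra.
  - unfold half_sin in Hn. unfold Rdiv in *. set (r := sqrt _) in *.
    replace (sqrt ((1 + - cos t) * / 2)) with r by (unfold r; f_equal; ring).
    field. auto.
Qed.

Lemma log_gap_ge1 q : 0 < q <= 1 -> 1 <= log_gap q.
Proof.
  intros [H1 H2]. unfold log_gap. destruct H2 as [H2| ->].
  - apply ln_increasing in H2; auto. rewrite ln_1 in H2. lra.
  - rewrite ln_1. lra.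
Qed.

Lemma is_derive_log_gap q : 0 < q -> is_derive log_gap q (- / q).
Proof. intros H. unfold log_gap. auto_derive; auto. field. lra. Qed.

Lemma half_sin_range t : half_sin t <> 0 ->
  0 < half_sin t <= 1 /\ 1 <= log_gap (half_sin t).
Proof.
  intros H. generalize (half_sin_ge0 t) (half_sin_le1 t); intros.
  assert (0 < half_sin t <= 1) by lra. split; auto. apply log_gap_ge1; auto.
Qed.

Lemma is_derive_blow t : half_sin t <> 0 -> is_derive blow t (blow1 (half_sin t)).
Proof.
  intros Hn. destruct (half_sin_range t Hn) as [Hq HL].
  generalize (is_derive_half_sin t Hn); intros Hd.
  assert (HLd := is_derive_comp log_gap half_sin t _ _ (is_derive_log_gap _ (proj1 Hq)) Hd).
  unfold blow.
  assert (Hden : is_derive (fun t => 2 * half_sin t * log_gap (half_sin t)) t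
     (2 * (sin t / (4 * half_sin t)) * log_gap (half_sin t) +
      2 * half_sin t * (sin t / (4 * half_sin t) * (- / half_sin t)))).
  { apply (is_derive_mult (fun t => 2 * half_sin t) (fun t => log_gap (half_sin t))).
    - apply is_derive_scal, Hd.
    - exact HLd.
    - intros; apply Rmult_comm. }
  set (q := half_sin t) in *. set (L := log_gap q) in *.
  evar_last.
  - apply (is_derive_plus (fun t => t)
      (fun t => sin t / (2 * half_sin t * log_gap (half_sin t)))); [apply is_derive_id|].
    apply is_derive_div; [apply is_derive_sin|exact Hden|].
    fold q L. nra.
  - fold q L. unfold plus, one; simpl. unfold blow1. fold L.
    assert (Ec : cos t = 1 - 2 * (q * q)) by (unfold q; rewrite half_sin_sqr; field).
    assert (Es : sin t * sin t = 4 * (q * q) * (1 - q * q)) by apply sin_half_sin.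
    rewrite Ec.
    (* The derivative of the denominator carries a factor sin t; together with the numerator it
       gives sin^2 t, which is 4 q^2 (1 - q^2). *)
    match goal with |- 1 + (?A - ?B) / ?C = _ =>
      replace B with (sin t * sin t * (L - 1) / (2 * q)) by (field; lra) end.
    rewrite Es. fold q; fold L. field. lra.
Qed.

Lemma is_derive_blow1 q : 0 < q <= 1 -> is_derive blow1 q (blow2 q).
Proof.
  intros Hq. assert (HL := log_gap_ge1 q Hq). assert (Hd := is_derive_log_gap q (proj1 Hq)).
  unfold blow1. auto_derive.
  - repeat split; try (exists (- / q); exact Hd). repeat apply Rmult_integral_contrapositive_currified; lra.
  - change (Derive (fun x => log_gap x) q) with (Derive log_gap q).
    rewrite (is_derive_unique _ _ _ Hd).
    unfold blow2. field. lra.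
Qed.

Lemma is_derive_blow1_half_sin t : half_sin t <> 0 ->
  is_derive (fun t => blow1 (half_sin t)) t (blow2 (half_sin t) * (sin t / (4 * half_sin t))).
Proof.
  intros Hn. destruct (half_sin_range t Hn) as [Hq HL].
  rewrite Rmult_comm.
  apply (is_derive_comp blow1 half_sin); [apply is_derive_blow1; auto|apply is_derive_half_sin; auto].
Qed.

(** The identity summand of [blow] pays for the only negative contribution, - q / (2 L), which is at
    least - 1/2 because q <= 1 <= L. *)
Lemma blow1_ge q : 0 < q <= 1 -> / 2 <= blow1 q.
Proof.
  intros Hq. assert (HL := log_gap_ge1 q Hq). unfold blow1. set (L := log_gap q) in *.
  replace (((1 - q * q) - q * q * L) / (2 * q * L ^ 2)) with
    ((1 - q * q) / (2 * q * L ^ 2) - q / (2 * L)) by (field; lra).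
  assert (0 <= (1 - q * q) / (2 * q * L ^ 2)).
  { apply Rdiv_le_0_compat; [nra|]. assert (0 < q * L) by nra. nra. }
  assert (q / (2 * L) <= / 2).
  { apply (Rmult_le_reg_r (2 * L)); [lra|]. replace (q / (2 * L) * (2 * L)) with q by (field; lra).
    lra. }
  lra.
Qed.

Lemma blow_lift : circle_lift blow.
Proof.
  intros t. unfold blow. rewrite half_sin_periodic, sin_plus, cos_2PI, sin_2PI.
  rewrite Rmult_0_r, Rplus_0_r, Rmult_1_r. ring.
Qed.

Lemma blow_0 : blow 0 = 0.
Proof. unfold blow. rewrite sin_0. lra. Qed.

Lemma is_lim_half_sin t0 : half_sin t0 = 0 -> is_lim half_sin t0 0.
Proof. intros E. rewrite <- E. apply continuous_is_lim, half_sin_cont. Qed.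

Lemma half_sin_shift t0 t : half_sin t0 = 0 -> half_sin t = half_sin (t - t0) /\ sin t = sin (t - t0).
Proof.
  intros E. destruct (half_sin_zero t0 E) as [k ->]. split.
  - replace t with (t - (0 + 2 * PI * IZR k) + 2 * PI * IZR k) at 1 by ring.
    apply periodic_Z, half_sin_periodic.
  - replace t with (t - (0 + 2 * PI * IZR k) + 2 * PI * IZR k) at 1 by ring.
    apply (periodic_Z sin). intros u. rewrite sin_plus, cos_2PI, sin_2PI. ring.
Qed.

Lemma half_sin_isolated t0 :
  exists d, 0 < d /\ forall t, t <> t0 -> Rabs (t - t0) < d -> half_sin t <> 0.
Proof.
  generalize PI_RGT_0; intros HP.
  destruct (Req_dec (half_sin t0) 0) as [E|E].
  - exists (2 * PI). split; [lra|]. intros t Hn Ht E'.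
    rewrite (proj1 (half_sin_shift t0 t E)) in E'. apply half_sin_zero in E'.
    destruct E' as [k Ek]. rewrite Rplus_0_l in Ek. rewrite Ek in Ht.
    apply Rabs_def2 in Ht.
    assert (H1 : IZR k < 1) by nra. assert (H2 : -1 < IZR k) by nra.
    apply lt_IZR in H1. apply lt_IZR in H2. replace k with 0%Z in Ek by lia. lra.
  - destruct (proj1 (locally_R _ _) (continuous_neq0_locally half_sin t0 (half_sin_cont t0) E))
      as (d & Hd & H). exists d. split; auto.
Qed.

Lemma is_lim_at_half_sin (g : R -> R) t0 l :
  half_sin t0 = 0 ->
  (forall e, 0 < e -> exists r, 0 < r /\ forall q, 0 < q <= 1 -> q < r -> Rabs (g q - l) < e) ->
  is_lim (fun t => g (half_sin t)) t0 l.
Proof.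
  intros E H. apply is_lim_R. intros e He. destruct (H e He) as (r & Hr & Hg).
  destruct (proj1 (is_lim_R _ _ _) (is_lim_half_sin t0 E) r Hr) as (d1 & Hd1 & H1).
  destruct (half_sin_isolated t0) as (d2 & Hd2 & H2).
  exists (Rmin d1 d2). split; [apply Rmin_pos; auto|]. intros y Hn Hy.
  assert (Hy1 : Rabs (y - t0) < d1) by (eapply Rlt_le_trans; [exact Hy|apply Rmin_l]).
  assert (Hy2 : Rabs (y - t0) < d2) by (eapply Rlt_le_trans; [exact Hy|apply Rmin_r]).
  specialize (H1 y Hn Hy1). rewrite Rminus_0_r in H1. apply Rabs_def2 in H1.
  apply Hg; [|lra]. apply half_sin_range. apply H2; auto.
Qed.

Lemma is_lim_inv_log t0 : half_sin t0 = 0 -> is_lim (fun t => / log_gap (half_sin t)) t0 0.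
Proof.
  intros E. apply (is_lim_at_half_sin (fun q => / log_gap q)); auto. intros e He.
  exists (exp (- / e)). split; [apply exp_pos|]. intros q Hq Hr.
  assert (HL := log_gap_ge1 q Hq).
  apply ln_increasing in Hr; [|lra]. rewrite ln_exp in Hr. unfold log_gap in *.
  assert (0 < / (1 - ln q)) by (apply Rinv_0_lt_compat; lra).
  rewrite Rminus_0_r, Rabs_pos_eq by lra.
  rewrite <- (Rinv_inv e). apply Rinv_lt_contravar; [|lra].
  apply Rmult_lt_0_compat; [apply Rinv_0_lt_compat; auto|lra].
Qed.

(** With r the fourth root of q, L = 1 - 4 ln r. The bound 1 + x <= exp x at x = - ln r gives r (1 -
    ln r) <= 1, hence r L <= 4, and q L^2 = r^2 (r L)^2. *)
Lemma log_gap_sqr_le q : 0 < q <= 1 -> q * log_gap q ^ 2 <= 16 * sqrt q.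
Proof.
  intros Hq. assert (HL := log_gap_ge1 q Hq).
  set (r := sqrt (sqrt q)).
  assert (Hs : 0 < sqrt q) by (apply sqrt_lt_R0; lra).
  assert (Hr : 0 < r) by (apply sqrt_lt_R0; auto).
  assert (E1 : r * r = sqrt q) by (apply sqrt_sqrt; lra).
  assert (E2 : sqrt q * sqrt q = q) by (apply sqrt_sqrt; lra).
  assert (E3 : ln q = 4 * ln r).
  { rewrite <- E2, <- E1, !ln_mult; try nra. }
  assert (Hl : r * log_gap q <= 4).
  { generalize (exp_ineq1_le (- ln r)). rewrite exp_Ropp, exp_ln by auto. intros H.
    unfold log_gap. rewrite E3.
    assert (r * (1 + - ln r) <= r * / r) by (apply Rmult_le_compat_l; lra).
    rewrite Rinv_r in H0 by lra.
    assert (r <= 1). { apply Rnot_lt_le. intros H1. assert (1 < r * r) by nra. nra. }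
    nra. }
  rewrite <- E2 at 1. rewrite <- E1 at 1 2.
  assert (0 <= r * log_gap q) by nra.
  assert ((r * log_gap q) * (r * log_gap q) <= 16) by nra.
  rewrite <- E1.
  replace (r * r * (r * r) * log_gap q ^ 2) with (r * r * ((r * log_gap q) * (r * log_gap q))) by ring.
  nra.
Qed.

Lemma is_lim_log_sqr t0 : half_sin t0 = 0 ->
  is_lim (fun t => half_sin t * log_gap (half_sin t) ^ 2) t0 0.
Proof.
  intros E. apply (is_lim_at_half_sin (fun q => q * log_gap q ^ 2)); auto. intros e He.
  exists ((e / 16) * (e / 16)). split; [nra|]. intros q Hq Hr.
  generalize (log_gap_sqr_le q Hq); intros H. assert (HL := log_gap_ge1 q Hq).
  assert (0 <= q * log_gap q ^ 2) by (apply Rmult_le_pos; [lra|apply pow2_ge_0]).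
  rewrite Rminus_0_r, Rabs_pos_eq by auto.
  assert (sqrt q < e / 16).
  { rewrite <- (sqrt_square (e / 16)) by lra. apply sqrt_lt_1; nra. }
  lra.
Qed.

Lemma is_lim_mult_R (f g : R -> R) (x a b : R) :
  is_lim f x a -> is_lim g x b -> is_lim (fun t => f t * g t) x (a * b).
Proof. intros Hf Hg. exact (is_lim_mult f g x a b Hf Hg I). Qed.

Lemma is_lim_plus_R (f g : R -> R) (x a b : R) :
  is_lim f x a -> is_lim g x b -> is_lim (fun t => f t + g t) x (a + b).
Proof. intros Hf Hg. apply (is_lim_plus f g x a b (a + b) Hf Hg). reflexivity. Qed.

Lemma is_lim_inv_R (f : R -> R) (x a : R) :
  is_lim f x a -> a <> 0 -> is_lim (fun t => / f t) x (/ a).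
Proof.
  intros Hf Ha. apply (is_lim_inv f x a); auto. intros E. injection E. auto.
Qed.

Ltac lims :=
  repeat match goal with
  | H : is_lim ?f ?x ?l |- is_lim ?f ?x ?l => exact H
  | |- is_lim (fun t => _ + _) _ _ => apply is_lim_plus_R
  | |- is_lim (fun t => _ * _) _ _ => apply is_lim_mult_R
  | |- is_lim (fun t => _) _ _ => apply is_lim_const
  | H : is_lim _ ?x _ |- is_lim _ ?x _ => exact H
  end.

Lemma is_lim_abs_R (f : R -> R) (x a : R) :
  is_lim f x a -> is_lim (fun t => Rabs (f t)) x (Rabs a).
Proof.
  rewrite !is_lim_R. intros H e He. destruct (H e He) as (d & Hd & H').
  exists d. split; auto. intros y Hn Hy. eapply Rle_lt_trans; [apply Rabs_triang_inv2|auto].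
Qed.

Lemma is_lim_cont (f : R -> R) (x : R) : continuous f x -> is_lim f x (f x).
Proof. apply continuous_is_lim. Qed.

Lemma is_lim_sinc_half t0 :
  is_lim (fun t => (t - t0) / 2 / sin ((t - t0) / 2)) t0 1.
Proof.
  assert (H : is_lim (fun t => sin ((t - t0) / 2) / ((t - t0) / 2)) t0 1).
  { apply (is_lim_comp (fun x => sin x / x) (fun t => (t - t0) / 2) t0 1 0).
    - apply is_lim_sinc_0.
    - replace (Finite 0) with (Finite ((t0 - t0) / 2)) by (f_equal; field).
      apply (is_lim_cont (fun t => (t - t0) / 2)).
      apply (ex_derive_continuous (fun t => (t - t0) / 2)). auto_derive. auto.
    - exists (mkposreal 1 Rlt_0_1). intros y _ Hy E. injection E. lra. }
  apply is_lim_inv_R in H; [|lra]. rewrite Rinv_1 in H.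
  refine (is_lim_locally' _ _ _ _ 1 Rlt_0_1 _ H). intros y _ _.
  unfold Rdiv at 1. rewrite Rinv_mult, Rinv_inv. unfold Rdiv. ring.
Qed.

(** Half angles turn the quotient into (h/2) / sin (h/2) times cos (h/2), with h = t - t0. It is one
    factor of (t - t0) F''/F' for F = [blow], the other being [q * blow2 q / blow1 q]. *)
Lemma is_lim_sin_ratio t0 : half_sin t0 = 0 ->
  is_lim (fun t => (t - t0) * sin t / (4 * half_sin t * half_sin t)) t0 1.
Proof.
  intros E. destruct (half_sin_isolated t0) as (d & Hd & Hi).
  assert (H : is_lim (fun t => (t - t0) / 2 / sin ((t - t0) / 2) * cos ((t - t0) / 2)) t0 (1 * cos ((t0 - t0) / 2))).
  { apply is_lim_mult_R; [apply is_lim_sinc_half|].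
    apply (is_lim_cont (fun t => cos ((t - t0) / 2))).
    apply (ex_derive_continuous (fun t => cos ((t - t0) / 2))). auto_derive. auto. }
  replace (1 * cos ((t0 - t0) / 2)) with 1 in H.
  2: { replace ((t0 - t0) / 2) with 0 by field. rewrite cos_0. ring. }
  refine (is_lim_locally' _ _ _ _ d Hd _ H). intros y Hn Hy.
  specialize (Hi y Hn Hy). destruct (half_sin_shift t0 y E) as [E1 E2].
  rewrite E2, Rmult_assoc, E1. rewrite E1 in Hi. set (h := y - t0) in *.
  rewrite half_sin_abs in Hi |- *.
  replace (Rabs (sin (h / 2)) * Rabs (sin (h / 2))) with (sin (h / 2) * sin (h / 2)).
  2: { rewrite <- Rabs_mult. symmetry. apply Rabs_pos_eq. apply Rle_0_sqr. }
  replace h with (2 * (h / 2)) at 5 by field. rewrite sin_2a. field.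
  intros E'. apply Hi. rewrite E'. apply Rabs_R0.
Qed.

(** * Limits at a node *)

Section AtNode.
Variable t0 : R.
Hypothesis Ht0 : half_sin t0 = 0.

Let q := half_sin.
(** The divergent logarithm is hidden in [al] = 1/L and [be] = q L^2, which tend to 0 together with
    q; for instance q^2 L is [q * be * al]. Then [blow1] is [num / (2 * be)], and each limit
    concerns a polynomial in small quantities, divided at most by [num]. *)
Let al := fun t => / log_gap (q t).
Let be := fun t => q t * log_gap (q t) ^ 2.
Let num := fun t => 1 + 2 * be t - q t * q t - q t * be t * al t.

Lemma num_lim : is_lim num t0 1.
Proof.
  assert (Hq := is_lim_half_sin t0 Ht0). assert (Ha := is_lim_inv_log t0 Ht0).
  assert (Hb := is_lim_log_sqr t0 Ht0). fold q in Hq, Ha, Hb. fold al in Ha. fold be in Hb.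
  replace 1 with (1 + 2 * 0 + (-1) * (0 * 0) + (-1) * (0 * 0 * 0)) by ring.
  apply (is_lim_ext (fun t => 1 + 2 * be t + (-1) * (q t * q t) + (-1) * (q t * be t * al t))).
  { intros t. unfold num. ring. }
  lims.
Qed.

Lemma node_punctured (f g : R -> R) (l : Rbar) :
  (forall t, 0 < q t <= 1 -> 1 <= log_gap (q t) -> f t = g t) -> is_lim f t0 l -> is_lim g t0 l.
Proof.
  intros H. destruct (half_sin_isolated t0) as (d & Hd & Hi).
  apply (is_lim_locally' _ _ _ _ d Hd). intros y Hn Hy.
  destruct (half_sin_range y (Hi y Hn Hy)). apply H; auto.
Qed.

Lemma blow1_num t : 0 < q t <= 1 -> 1 <= log_gap (q t) -> blow1 (q t) = num t / (2 * be t).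
Proof. intros. unfold blow1, num, be, al. field. lra. Qed.

(** To leading order [blow1] is 1 / (2 q L^2) and [blow2] is - 1 / (2 q^2 L^2). This limit -1 is
    what cancels the derivative of a field at the node. *)
Lemma is_lim_blow_ratio :
  is_lim (fun t => half_sin t * blow2 (half_sin t) / blow1 (half_sin t)) t0 (-1).
Proof.
  assert (Hq := is_lim_half_sin t0 Ht0). assert (Ha := is_lim_inv_log t0 Ht0).
  assert (Hb := is_lim_log_sqr t0 Ht0). fold q in Hq, Ha, Hb. fold al in Ha. fold be in Hb.
  apply (node_punctured (fun t => (-1 + 2 * al t + (-1) * (q t * q t * (2 + 2 * al t)) +
      (-1) * (q t * be t * al t)) * / num t)).
  - intros t H1 H2. fold q.
    assert (H3 := blow1_ge (q t) H1).
    assert (Hn : num t <> 0).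
    { rewrite (blow1_num t H1 H2) in H3. intros E. rewrite E in H3. unfold Rdiv in H3. lra. }
    rewrite (blow1_num t H1 H2). unfold blow2. revert Hn.
    unfold al, be. intros Hn. field. repeat split; try lra; auto.
  - replace (-1) with ((-1 + 2 * 0 + (-1) * (0 * 0 * (2 + 2 * 0)) + (-1) * (0 * 0 * 0)) * / 1) at 1
      by field.
    apply is_lim_mult_R; [|apply is_lim_inv_R; [apply num_lim|lra]].
    lims.
Qed.

Lemma is_lim_q_blow1 : is_lim (fun t => half_sin t * blow1 (half_sin t)) t0 0.
Proof.
  assert (Hq := is_lim_half_sin t0 Ht0). assert (Ha := is_lim_inv_log t0 Ht0).
  fold q in Hq, Ha. fold al in Ha.
  apply (node_punctured (fun t => q t + / 2 * (al t * al t) + (- / 2) * (q t * q t * (al t * al t)) +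
       (- / 2) * (q t * q t * al t))).
  - intros t H1 H2. fold q. unfold blow1, al. field. lra.
  - replace 0 with (0 + / 2 * (0 * 0) + (- / 2) * (0 * 0 * (0 * 0)) + (- / 2) * (0 * 0 * 0)) at 1 by ring.
    lims.
Qed.

(** F' is infinite at the node but only o(1/|t - t0|), so w F' still tends to 0 for a differentiable
    field w vanishing there. Absolute values are taken because |t - t0| is comparable with q,
    without its sign. *)
Lemma is_lim_shift_blow1 : is_lim (fun t => (t - t0) * blow1 (half_sin t)) t0 0.
Proof.
  assert (H : is_lim (fun t => 2 * Rabs ((t - t0) / 2 / sin ((t - t0) / 2)) *
     Rabs (half_sin t * blow1 (half_sin t))) t0 (2 * Rabs 1 * Rabs 0)).
  { apply is_lim_mult_R; [apply is_lim_mult_R; [apply is_lim_const|]|].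
    - exact (is_lim_abs_R _ _ _ (is_lim_sinc_half t0)).
    - exact (is_lim_abs_R _ _ _ is_lim_q_blow1). }
  replace (2 * Rabs 1 * Rabs 0) with 0 in H by (rewrite Rabs_R0; ring).
  assert (H' : is_lim (fun t => Rabs ((t - t0) * blow1 (half_sin t))) t0 0).
  { apply (fun K => node_punctured _ _ _ K H). intros t H1 H2. unfold q in *.
    rewrite (Rabs_mult (t - t0)), (Rabs_mult (half_sin t)), (Rabs_pos_eq (half_sin t)) by lra.
    assert (E : half_sin t = Rabs (sin ((t - t0) / 2))).
    { rewrite (proj1 (half_sin_shift t0 t Ht0)). apply half_sin_abs. }
    assert (Hs : Rabs (sin ((t - t0) / 2)) <> 0) by lra.
    unfold Rdiv at 1. rewrite Rabs_mult, Rabs_inv, E. unfold Rdiv at 1.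
    rewrite Rabs_mult, (Rabs_pos_eq (/ 2)) by lra. field. auto. }
  apply is_lim_R. intros e He. destruct (proj1 (is_lim_R _ _ _) H' e He) as (d & Hd & Hf).
  exists d. split; auto. intros y Hn Hy. specialize (Hf y Hn Hy).
  rewrite Rminus_0_r, Rabs_Rabsolu in Hf. rewrite Rminus_0_r. exact Hf.
Qed.

Lemma is_lim_blow1 : is_lim (fun t => blow1 (half_sin t)) t0 p_infty.
Proof.
  apply (fun K => node_punctured (fun t => num t / (2 * be t)) _ p_infty K).
  { intros t H1 H2. rewrite <- (blow1_num t H1 H2). reflexivity. }
  assert (Hn := num_lim). assert (Hb := is_lim_log_sqr t0 Ht0). fold q in Hb. fold be in Hb.
  apply is_lim_spec. intros A.
  set (B := Rabs A + 1). assert (HB : 0 < B) by (unfold B; generalize (Rabs_pos A); lra).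
  assert (HA : A < B) by (unfold B; generalize (Rle_abs A); lra).
  (* Once num > 1/2 and 0 < be < 1 / (4 B), the quotient num / (2 be) exceeds B. *)
  destruct (proj1 (is_lim_R _ _ _) Hn (/ 2)) as (d1 & Hd1 & H1); [lra|].
  destruct (proj1 (is_lim_R _ _ _) Hb (/ (4 * B))) as (d2 & Hd2 & H2);
    [apply Rinv_0_lt_compat; lra|].
  destruct (half_sin_isolated t0) as (d3 & Hd3 & H3).
  assert (Hd : 0 < Rmin d1 (Rmin d2 d3)) by (repeat apply Rmin_pos; auto).
  exists (mkposreal _ Hd). intros y Hy Hyn.
  assert (Hy' : Rabs (y - t0) < Rmin d1 (Rmin d2 d3)) by exact Hy.
  assert (Hy1 : Rabs (y - t0) < d1) by (eapply Rlt_le_trans; [exact Hy'|apply Rmin_l]).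
  assert (Hy2 : Rabs (y - t0) < d2).
  { eapply Rlt_le_trans; [exact Hy'|]. eapply Rle_trans; [apply Rmin_r|apply Rmin_l]. }
  assert (Hy3 : Rabs (y - t0) < d3).
  { eapply Rlt_le_trans; [exact Hy'|]. eapply Rle_trans; [apply Rmin_r|apply Rmin_r]. }
  specialize (H1 y Hyn Hy1). specialize (H2 y Hyn Hy2). specialize (H3 y Hyn Hy3).
  destruct (half_sin_range y H3) as [Hq HL]. fold q in Hq, HL.
  apply Rabs_def2 in H1. apply Rabs_def2 in H2.
  assert (Hbe : 0 < be y) by (unfold be; apply Rmult_lt_0_compat; [lra|apply pow_lt; lra]).
  assert (be y * (4 * B) < 1).
  { rewrite <- (Rinv_l (4 * B)) by lra. apply Rmult_lt_compat_r; lra. }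
  eapply Rlt_trans; [exact HA|]. apply (Rmult_lt_reg_r (2 * be y)); [lra|].
  unfold Rdiv. rewrite Rmult_assoc, Rinv_l by lra. nra.
Qed.

Lemma blow_cont_node : continuous blow t0.
Proof.
  apply continuous_is_lim.
  assert (E : blow t0 = t0 + 0).
  (* Division by zero yields 0 here, which is also the limit of the correction term: it is bounded
     by 1/L. *)
  { unfold blow. rewrite Ht0. unfold Rdiv. rewrite Rmult_0_r, Rmult_0_l, Rinv_0. ring. }
  rewrite E. apply (is_lim_plus_R (fun t => t)); [apply is_lim_id|].
  assert (Ha := is_lim_inv_log t0 Ht0).
  apply is_lim_R. intros e He. destruct (proj1 (is_lim_R _ _ _) Ha e He) as (d1 & Hd1 & H1).
  destruct (half_sin_isolated t0) as (d3 & Hd3 & H3).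
  exists (Rmin d1 d3). split; [apply Rmin_pos; auto|]. intros y Hn Hy.
  assert (Hy1 : Rabs (y - t0) < d1) by (eapply Rlt_le_trans; [exact Hy|apply Rmin_l]).
  assert (Hy2 : Rabs (y - t0) < d3) by (eapply Rlt_le_trans; [exact Hy|apply Rmin_r]).
  specialize (H1 y Hn Hy1). destruct (half_sin_range y (H3 y Hn Hy2)) as [Hq HL].
  rewrite Rminus_0_r in *. eapply Rle_lt_trans; [|exact H1].
  assert (Hi : 0 < / log_gap (half_sin y)) by (apply Rinv_0_lt_compat; lra).
  rewrite (Rabs_pos_eq (/ _)) by lra.
  replace (sin y / (2 * half_sin y * log_gap (half_sin y))) with
    ((sin y / (2 * half_sin y)) * / log_gap (half_sin y)) by (field; lra).
  rewrite Rabs_mult, (Rabs_pos_eq (/ _)) by lra.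
  rewrite <- (Rmult_1_l (/ log_gap _)) at 2. apply Rmult_le_compat_r; [lra|].
  unfold Rdiv. rewrite Rabs_mult, Rabs_inv, (Rabs_pos_eq (2 * half_sin y)) by lra.
  apply (Rmult_le_reg_r (2 * half_sin y)); [lra|]. rewrite Rmult_assoc, Rinv_l by lra.
  rewrite Rmult_1_l, Rmult_1_r. apply Rnot_lt_le. intros Hlt.
  assert (E2 : Rabs (sin y) * Rabs (sin y) = sin y * sin y).
  { rewrite <- Rabs_mult. apply Rabs_pos_eq. apply Rle_0_sqr. }
  rewrite sin_half_sin in E2. set (b := half_sin y) in *. clearbody b.
  assert (0 <= b * b * (b * b)) by apply Rle_0_sqr.
  nra.
Qed.
End AtNode.

Lemma blow_cont t : continuous blow t.
Proof.
  destruct (Req_dec (half_sin t) 0) as [E|E].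
  - apply blow_cont_node, E.
  - eapply is_derive_cont, is_derive_blow, E.
Qed.

Lemma blow_incr x y : x < y -> blow x < blow y.
Proof.
  generalize PI_RGT_0; intros HP.
  assert (Hb : forall x y, 0 <= x -> x < y -> y <= 2 * PI -> blow x < blow y).
  { intros a b Ha Hab Hb.
    destruct (MVT_R blow (fun t => blow1 (half_sin t)) a b Hab) as (c & Hc & E).
    - intros t Ht. apply is_derive_blow. intros E. apply half_sin_zero in E.
      destruct E as [k Ek]. rewrite Rplus_0_l in Ek.
      assert (H1 : IZR k < 1) by nra. assert (H2 : 0 < IZR k) by nra.
      apply lt_IZR in H1. apply lt_IZR in H2. lia.
    - intros t _. apply blow_cont.
    - assert (Hq : half_sin c <> 0).
      { intros E'. apply half_sin_zero in E'.
        destruct E' as [k Ek]. rewrite Rplus_0_l in Ek.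
        assert (H1 : IZR k < 1) by nra. assert (H2 : 0 < IZR k) by nra.
        apply lt_IZR in H1. apply lt_IZR in H2. lia. }
      assert (H := blow1_ge _ (proj1 (half_sin_range c Hq))). nra. }
  assert (HZ : forall u k, blow (u + 2 * PI * IZR k) = blow u + 2 * PI * IZR k)
    by (intros; apply circle_lift_Z, blow_lift).
  assert (H2 : blow (2 * PI) = 2 * PI).
  { replace (2 * PI) with (0 + 2 * PI) at 1 by ring. rewrite blow_lift, blow_0. ring. }
  assert (Hb0 : forall u, 0 <= u < 2 * PI -> 0 <= blow u < 2 * PI).
  { intros u Hu. split.
    - destruct (Req_dec u 0) as [->|]; [rewrite blow_0; lra|].
      rewrite <- blow_0. apply Rlt_le, Hb; lra.
    - rewrite <- H2. apply Hb; lra. }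
  intros Hxy. destruct (shift_into 0 x) as [i Hi]. destruct (shift_into 0 y) as [j Hj].
  assert (Bx := HZ x i). assert (By := HZ y j).
  set (x' := x + 2 * PI * IZR i) in *. set (y' := y + 2 * PI * IZR j) in *.
  (* [blow] maps [0, 2 PI) into itself, so points of different periods keep their order; otherwise x
     < y leaves only the case of a common period. *)
  destruct (Z_lt_le_dec j i) as [Hji|Hij].
  - assert (IZR j + 1 <= IZR i) by (rewrite <- plus_IZR; apply IZR_le; lia).
    generalize (Hb0 x' ltac:(lra)) (Hb0 y' ltac:(lra)). nra.
  - assert (Hle : IZR i <= IZR j) by (apply IZR_le; lia).
    assert (j = i).
    { apply Z.le_antisymm; auto. apply Z.lt_succ_r. apply lt_IZR. rewrite succ_IZR.
      unfold x', y' in *. nra. }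
    subst j. unfold x', y' in *.
    assert (blow (x + 2 * PI * IZR i) < blow (y + 2 * PI * IZR i)) by (apply Hb; lra). lra.
Qed.

Lemma is_lim_shift (g : R -> R) (c t0 : R) (l : Rbar) :
  is_lim g (t0 - c) l -> is_lim (fun t => g (t - c)) t0 l.
Proof.
  intros H. apply (is_lim_comp g (fun t => t - c) t0 l (t0 - c) H).
  - apply (is_lim_cont (fun t => t - c)).
    apply (ex_derive_continuous (fun t => t - c)). auto_derive. auto.
  - exists (mkposreal 1 Rlt_0_1). intros y _ Hy E. injection E. lra.
Qed.

(** * Blow-up at an arbitrary point and its effect on fields *)

Definition blow_at (c t : R) : R := c + blow (t - c).
Definition blow_at1 (c t : R) : R := blow1 (half_sin (t - c)).
Definition blow_at2 (c t : R) : R :=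
  blow2 (half_sin (t - c)) * (sin (t - c) / (4 * half_sin (t - c))).

Lemma is_derive_shift (g : R -> R) (c t d : R) :
  is_derive g (t - c) d -> is_derive (fun t => g (t - c)) t d.
Proof.
  intros H. replace d with (1 * d) by ring.
  apply (is_derive_comp g (fun t => t - c) t d 1 H). auto_derive; auto; ring.
Qed.

Lemma is_derive_blow_at c t : half_sin (t - c) <> 0 -> is_derive (blow_at c) t (blow_at1 c t).
Proof.
  intros H. apply is_derive_blow in H. apply is_derive_shift in H.
  unfold blow_at. replace (blow_at1 c t) with (0 + blow_at1 c t) by ring.
  apply (is_derive_plus (fun _ => c) (fun t => blow (t - c))); [|exact H].
  apply (is_derive_const (V := R_NormedModule)).
Qed.

Lemma is_derive_blow_at1 c t :
  half_sin (t - c) <> 0 -> is_derive (blow_at1 c) t (blow_at2 c t).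
Proof.
  intros H. apply is_derive_blow1_half_sin in H.
  exact (is_derive_shift (fun t => blow1 (half_sin t)) c t _ H).
Qed.

Lemma blow_at2_cont c t : half_sin (t - c) <> 0 -> continuous (blow_at2 c) t.
Proof.
  intros Hn. destruct (half_sin_range _ Hn) as [Hq HL].
  apply (continuous_comp (fun t => t - c) (fun t => blow2 (half_sin t) * (sin t / (4 * half_sin t)))).
  { apply (ex_derive_continuous (fun t => t - c)). auto_derive. auto. }
  apply (continuous_mult (fun t => blow2 (half_sin t)) (fun t => sin t / (4 * half_sin t))).
  - apply continuous_comp; [apply half_sin_cont|]. unfold blow2.
    assert (Hd := is_derive_log_gap _ (proj1 Hq)). set (q := half_sin (t - c)) in *.
    apply (ex_derive_continuous (fun q =>
      (- 1 + 2 / log_gap q - q * q * (2 + 2 / log_gap q + log_gap q)) / (2 * q ^ 2 * log_gap q ^ 2))).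
    auto_derive. repeat split; try (exists (- / q); exact Hd); try lra.
    repeat apply Rmult_integral_contrapositive_currified; lra.
  - assert (Hd := is_derive_half_sin _ Hn).
    apply (ex_derive_continuous (fun t => sin t / (4 * half_sin t))).
    auto_derive. split; [eexists; exact Hd|lra].
Qed.

Lemma blow_at_lift c : circle_lift (blow_at c).
Proof.
  intros t. unfold blow_at. replace (t + 2 * PI - c) with (t - c + 2 * PI) by ring.
  rewrite blow_lift. ring.
Qed.

Lemma blow_at_incr c x y : x < y -> blow_at c x < blow_at c y.
Proof. intros H. unfold blow_at. apply Rplus_lt_compat_l, blow_incr. lra. Qed.

Lemma blow_at_cont c t : continuous (blow_at c) t.
Proof.
  apply (continuous_plus (fun _ => c) (fun t => blow (t - c))); [apply continuous_const|].
  apply (continuous_comp (fun t => t - c) blow); [|apply blow_cont].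
  apply (ex_derive_continuous (fun t => t - c)). auto_derive. auto.
Qed.

Lemma node_isolated c t :
  exists d, 0 < d /\ forall y, y <> t -> Rabs (y - t) < d -> half_sin (y - c) <> 0.
Proof.
  destruct (half_sin_isolated (t - c)) as (d & Hd & H). exists d. split; auto.
  intros y Hn Hy. apply H; [lra|]. replace (y - c - (t - c)) with (y - t) by ring. auto.
Qed.

Lemma node_regular_locally c t : half_sin (t - c) <> 0 ->
  locally t (fun y => half_sin (y - c) <> 0).
Proof.
  intros Hn. apply locally_R. destruct (node_isolated c t) as (d & Hd & H).
  exists d. split; auto. intros y Hy. destruct (Req_dec y t) as [->|]; auto.
Qed.

Lemma blow_at_transformation c :
  circle_transformation (blow_at c) /\
  (forall t, half_sin (t - c) <> 0 ->
     cont_diff_at (blow_at c) t /\ Derive (blow_at c) t = blow_at1 c t) /\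
  exists K : R -> R, (forall s, blow_at c (K s) = s) /\ (forall t, K (blow_at c t) = t) /\
    (forall s, continuous K s).
Proof.
  destruct (lift_bijective (blow_at c) (blow_at_lift c) (blow_at_incr c) (blow_at_cont c))
    as [Hbij HK].
  assert (Hreg : forall t, half_sin (t - c) <> 0 ->
     cont_diff_at (blow_at c) t /\ Derive (blow_at c) t = blow_at1 c t).
  { intros t Hn. split.
    - apply cont_diff_of with (blow_at1 c).
      + refine (filter_imp _ _ _ (node_regular_locally c t Hn)). intros y. apply is_derive_blow_at.
      + eapply is_derive_cont, is_derive_blow_at1, Hn.
    - apply is_derive_unique, is_derive_blow_at, Hn. }
  assert (Hbad : forall t, ~ cont_diff_at (blow_at c) t -> half_sin (t - c) = 0).
  { intros t H. apply NNPP. intros Hn. apply H, Hreg, Hn. }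
  split; [|split; auto].
  split; [exact Hbij|split; [apply blow_at_cont|split]].
  - exists (c :: nil). intros t Ht. exists c. split; [left; auto|].
    destruct (half_sin_zero _ (Hbad t Ht)) as [k Hk]. exists k. lra.
  - intros t Ht. left. assert (E := Hbad t Ht).
    destruct (node_isolated c t) as (d & Hd & H).
    refine (is_lim_locally' (blow_at1 c) _ t _ d Hd _ _).
    + intros y Hn Hy. symmetry. apply Hreg; auto.
    + exact (is_lim_shift (fun t => blow1 (half_sin t)) c t _ (is_lim_blow1 _ E)).
Qed.

(** Derivative of the transported field, read at the old coordinate. The value 0 at a node is the
    limit of the second expression when [w] vanishes there, whatever the value of w'. *)
Definition blown_derivative (c : R) (w : R -> R) (t : R) : R :=
  if Req_EM_T (half_sin (t - c)) 0 then 0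
  else Derive w t + w t * (blow_at2 c t / blow_at1 c t).

Lemma blown_field (c : R) (K w : R -> R) :
  (forall s, blow_at c (K s) = s) -> (forall t, K (blow_at c t) = t) ->
  (forall s, continuous K s) -> C1_field w -> w c = 0 ->
  C1_field (fun s => w (K s) * blow_at1 c (K s)) /\
  forall t, Derive (fun s => w (K s) * blow_at1 c (K s)) (blow_at c t) = blown_derivative c w t.
Proof.
  intros HFK HKF HK Hw Hc.
  apply (push_field (blow_at c) (blow_at1 c) (blow_at2 c) K w (blown_derivative c w)
    (fun t => half_sin (t - c) = 0)); auto.
  - apply blow_at_lift.
  - intros t. unfold blow_at1. replace (t + 2 * PI - c) with (t - c + 2 * PI) by ring.
    rewrite half_sin_periodic. reflexivity.
  - apply node_isolated.
  - intros t Hn. split; [|split; [|split; [|split]]].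
    + apply is_derive_blow_at, Hn.
    + apply is_derive_blow_at1, Hn.
    + apply blow_at2_cont, Hn.
    + assert (H := blow1_ge _ (proj1 (half_sin_range _ Hn))). unfold blow_at1. lra.
    + unfold blown_derivative. destruct Req_EM_T; [contradiction|reflexivity].
  - intros t Hb.
    assert (Hwt : w t = 0).
    { destruct (half_sin_zero _ Hb) as [k Hk]. replace t with (c + 2 * PI * IZR k) by lra.
      rewrite periodic_Z; [auto|apply Hw]. }
    assert (Hsl : is_lim (fun y => w y / (y - t)) t (Derive w t)).
    { assert (H := proj1 (is_derive_slope _ _ _) (C1_field_derive w t Hw)).
      refine (is_lim_ext _ _ _ _ _ H). intros y. rewrite Hwt, Rminus_0_r. reflexivity. }
    destruct (node_isolated c t) as (d & Hd & Hi).
    split; [exact Hwt|split; [|split]].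
    + unfold blown_derivative. destruct Req_EM_T; [reflexivity|contradiction].
    + assert (H := is_lim_shift _ c t _ (is_lim_shift_blow1 _ Hb)). cbv beta in H.
      assert (H' := is_lim_mult_R _ _ _ _ _ Hsl H). cbv beta in H'. rewrite Rmult_0_r in H'.
      refine (is_lim_locally' _ _ _ _ 1 Rlt_0_1 _ H'). intros y Hn _.
      unfold blow_at1. field. lra.
    + assert (HT := is_lim_shift _ c t _ (is_lim_sin_ratio _ Hb)). cbv beta in HT.
      assert (HR := is_lim_shift _ c t _ (is_lim_blow_ratio _ Hb)). cbv beta in HR.
      assert (HD := is_lim_cont _ _ (C1_field_cont_D w t Hw)).
      (* w F''/F' is the slope w / (t - t0), tending to w', times (t - t0) F''/F', tending to -1;
         the sum with w' vanishes in the limit. *)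
      assert (H := is_lim_plus_R _ _ _ _ _ HD (is_lim_mult_R _ _ _ _ _ Hsl
          (is_lim_mult_R _ _ _ _ _ HT HR))). cbv beta in H.
      replace (Derive w t + Derive w t * (1 * -1)) with 0 in H by ring.
      refine (is_lim_locally' _ _ _ _ d Hd _ H). intros y Hn Hy.
      specialize (Hi y Hn Hy). assert (Hq := half_sin_range _ Hi).
      assert (H1 := blow1_ge _ (proj1 Hq)).
      unfold blow_at1, blow_at2. field. repeat split; lra.
Qed.

(** The new derivative of V is V' + V F''/F'. At zeros of W away from the node V = 0 as well, so V'
    keeps its value there; hence the zeros can be treated one after another without spoiling the
    earlier ones. *)
Lemma desingularize_node (W V : R -> R) (n : nat) (z : nat -> R) (c : R) :
  affine_pair W V -> zero_chain W n z -> W c = 0 ->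
  exists F W1 V1 : R -> R, affine_pair W1 V1 /\ zero_chain W1 n (fun k => F (z k)) /\
    (forall A : (R -> R) -> Prop, (forall u, A u <-> span2 W V u) ->
       transformation_step A (span2 W1 V1)) /\
    Derive V1 (F c) = 0 /\
    forall t, W t = 0 -> Derive V t = 0 -> Derive V1 (F t) = 0.
Proof.
  intros HP Hz Hc. generalize HP; intros (HW & HV & Hb & Hn).
  assert (HVc := pair_zero W V c HP Hc).
  destruct (blow_at_transformation c) as (HF & Hreg & K & HFK & HKF & HK).
  destruct (blown_field c K W HFK HKF HK HW Hc) as [HW1 HDW1].
  destruct (blown_field c K V HFK HKF HK HV HVc) as [HV1 HDV1].
  set (W1 := fun s => W (K s) * blow_at1 c (K s)) in *.
  set (V1 := fun s => V (K s) * blow_at1 c (K s)) in *.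
  set (F := blow_at c) in *.
  assert (EW : forall t, W1 (F t) = W t * blow_at1 c t) by (intros t; unfold W1; rewrite HKF; auto).
  assert (EV : forall t, V1 (F t) = V t * blow_at1 c t) by (intros t; unfold V1; rewrite HKF; auto).
  assert (Hnode : forall t, half_sin (t - c) = 0 -> W t = 0).
  { intros t E. destruct (half_sin_zero _ E) as [k Hk]. replace t with (c + 2 * PI * IZR k) by lra.
    rewrite periodic_Z; [auto|apply HW]. }
  assert (Hpos : forall t, half_sin (t - c) <> 0 -> 0 < blow_at1 c t).
  { intros t E. assert (H := blow1_ge _ (proj1 (half_sin_range _ E))). unfold blow_at1. lra. }
  assert (HW0 : forall t, W t <> 0 -> W1 (F t) <> 0).
  { intros t Ht. assert (E : half_sin (t - c) <> 0) by (intros E; apply Ht, Hnode, E).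
    rewrite EW. specialize (Hpos t E). apply Rmult_integral_contrapositive_currified; lra. }
  exists F, W1, V1. split; [|split; [|split; [|split]]].
  - split; [exact HW1|split; [exact HV1|split]].
    + intros s. rewrite <- (HFK s). set (t := K s). fold F. unfold bracket.
      fold F in HDW1, HDV1.
      rewrite HDW1, HDV1, EW, EV. unfold blown_derivative.
      destruct (Req_EM_T (half_sin (t - c)) 0) as [E|E].
      * rewrite (Hnode t E), (pair_zero W V t HP (Hnode t E)). ring.
      (* The terms with F''/F' cancel in the bracket, leaving F' times the old bracket, which is the
         transform of W. *)
      * specialize (Hpos t E). specialize (Hb t). unfold bracket in Hb. rewrite <- Hb at 3. field. lra.
    + intros a b Hab H.
      assert (Hlt : K a < K b).
      { apply Rnot_le_lt. intros [Hl|He].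
        - apply (blow_at_incr c) in Hl. rewrite !HFK in Hl. lra.
        - assert (b = a) by (rewrite <- (HFK a), <- (HFK b), He; auto). lra. }
      apply (Hn _ _ Hlt). intros t Ht. apply NNPP. intros Hnt. apply (HW0 t Hnt), H.
      rewrite <- (HFK a), <- (HFK b). split; apply blow_at_incr; lra.
  - destruct Hz as (Hn1 & Hz1 & Hz2 & Hz3). split; [auto|split; [|split]].
    + rewrite Hz1. apply blow_at_lift.
    + intros k Hk. rewrite EW, Hz2 by auto. ring.
    + intros k Hk. destruct (Hz3 k Hk) as [H1 H2]. split; [apply blow_at_incr, H1|].
      intros s Hs. rewrite <- (HFK s) in *. apply HW0, H2.
      set (t := K s) in *. fold F in Hs. split; apply Rnot_le_lt; intros [Hl|He].
      * apply (blow_at_incr c) in Hl. fold F in Hl. lra.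
      * rewrite He in Hs. lra.
      * apply (blow_at_incr c) in Hl. fold F in Hl. lra.
      * rewrite He in Hs. lra.
  - intros A HA. apply (step_span A F W V W1 V1); auto.
    + intros t Ht. rewrite EW, EV. destruct (Req_dec (half_sin (t - c)) 0) as [E|E].
      * rewrite (Hnode t E), (pair_zero W V t HP (Hnode t E)). lra.
      * destruct (Hreg t E) as [_ E']. rewrite E'. auto.
    + intros s. destruct (node_isolated c (K s)) as (d & Hd & Hi).
      destruct (proj1 (continuous_R _ _) (HK s) d Hd) as (r & Hr & H).
      exists r. split; auto. intros y Hny Hy. exists (K y). split; [|apply HFK].
      apply Hreg, Hi; [|apply H, Hy]. intros E. apply Hny. rewrite <- (HFK y), <- (HFK s), E. auto.
  - fold F in HDV1. rewrite HDV1. unfold blown_derivative. destruct Req_EM_T as [|E]; auto.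
    exfalso. apply E. replace (c - c) with (2 * PI * IZR 0) by ring. apply half_sin_0.
  - intros t Ht HDt. fold F in HDV1. rewrite HDV1. unfold blown_derivative.
    destruct Req_EM_T; auto. rewrite HDt, (pair_zero W V t HP Ht). ring.
Qed.

Lemma desingularize (W V : R -> R) (n : nat) (z : nat -> R) (A : (R -> R) -> Prop) :
  affine_pair W V -> zero_chain W n z -> (forall u, A u <-> span2 W V u) ->
  exists (W1 V1 : R -> R) (z1 : nat -> R), affine_pair W1 V1 /\ zero_chain W1 n z1 /\
    equivalent A (span2 W1 V1) /\ forall k, (k < n)%nat -> Derive V1 (z1 k) = 0.
Proof.
  intros HP Hz HA.
  (* The induction starts at one treated zero because [equivalent] requires at least one step. *)
  assert (H : forall m, (1 <= m <= n)%nat ->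
    exists (W1 V1 : R -> R) (z1 : nat -> R), affine_pair W1 V1 /\ zero_chain W1 n z1 /\
      equivalent A (span2 W1 V1) /\ forall k, (k < m)%nat -> Derive V1 (z1 k) = 0).
  { induction m as [|m IH]; intros Hm; [lia|].
    destruct (Nat.eq_dec m 0) as [->|Hm0].
    - destruct (desingularize_node W V n z (z 0%nat) HP Hz) as (F & W1 & V1 & HP1 & Hz1 & HT & HD & _).
      { apply Hz. lia. }
      exists W1, V1, (fun k => F (z k)). split; [auto|split; [auto|split]].
      + apply t_step, HT, HA.
      + intros k Hk. replace k with 0%nat by lia. auto.
    - destruct IH as (W1 & V1 & z1 & HP1 & Hz1 & HE & HD1); [lia|].
      destruct (desingularize_node W1 V1 n z1 (z1 m) HP1 Hz1)
        as (F & W2 & V2 & HP2 & Hz2 & HT & HD & HD').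
      { apply Hz1. lia. }
      exists W2, V2, (fun k => F (z1 k)). split; [auto|split; [auto|split]].
      + apply t_trans with (span2 W1 V1); auto. apply t_step, HT. intros u. tauto.
      + intros k Hk. destruct (Nat.eq_dec k m) as [->|]; auto.
        apply HD'; [apply Hz1; lia|apply HD1; lia]. }
  destruct Hz as (Hn & _). apply H. lia.
Qed.

(** * Behaviour near a flat zero *)

Lemma pair_opp (W V : R -> R) : affine_pair W V -> affine_pair (fun t => - W t) V.
Proof.
  intros (HW & HV & Hb & Hn).
  destruct (C1_field_lin W V (fun t => - W t) (-1) 0 HW HV) as [HC HD]; [intros; ring|].
  split; [exact HC|split; [exact HV|split]].
  - intros t. generalize (Hb t). unfold bracket. rewrite HD. intros. lra.
  - intros a b Hab H. apply (Hn a b Hab). intros t Ht. specialize (H t Ht). lra.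
Qed.

Lemma field_reflect (w : R -> R) : C1_field w ->
  C1_field (fun t => - w (- t)) /\ forall t, Derive (fun t => - w (- t)) t = Derive w (- t).
Proof.
  intros Hw.
  assert (Hd : forall t, is_derive (fun t => - w (- t)) t (Derive w (- t))).
  { intros t. replace (Derive w (- t)) with (- (- 1 * Derive w (- t))) by ring.
    apply (is_derive_opp (fun t => w (- t))).
    apply (is_derive_comp w Ropp t _ (-1)); [apply C1_field_derive, Hw|].
    auto_derive; auto; ring. }
  split; [|intros t; apply is_derive_unique, Hd].
  apply C1_field_of with (fun t => Derive w (- t)); auto.
  - intros t. destruct Hw as [Hw _]. rewrite <- (Hw (- (t + 2 * PI))). do 2 f_equal. ring.
  - intros t. apply (continuous_comp Ropp (Derive w)); [|apply C1_field_cont_D, Hw].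
    apply (ex_derive_continuous Ropp). auto_derive. auto.
Qed.

(** Push-forward under t -> - t, which preserves brackets. Together with [pair_opp] it reduces local
    statements to the right of a zero and to positive W. *)
Lemma pair_reflect (W V : R -> R) :
  affine_pair W V -> affine_pair (fun t => - W (- t)) (fun t => - V (- t)).
Proof.
  intros (HW & HV & Hb & Hn).
  destruct (field_reflect W HW) as [HW' DW]. destruct (field_reflect V HV) as [HV' DV].
  split; [exact HW'|split; [exact HV'|split]].
  - intros t. generalize (Hb (- t)). unfold bracket. rewrite DW, DV. intros. lra.
  - intros a b Hab H. apply (Hn (- b) (- a)); [lra|]. intros t Ht.
    specialize (H (- t)). rewrite Ropp_involutive in H. assert (- W t = 0) by (apply H; lra). lra.
Qed.

Lemma nonzero_sign (f : R -> R) (a b : R) :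
  (forall t, continuous f t) -> (forall t, a < t < b -> f t <> 0) ->
  (forall t, a < t < b -> 0 < f t) \/ (forall t, a < t < b -> f t < 0).
Proof.
  intros Hc Hn. apply NNPP. intros H. apply not_or_and in H. destruct H as [H1 H2].
  apply not_all_ex_not in H1. destruct H1 as [x Hx]. apply imply_to_and in Hx.
  apply not_all_ex_not in H2. destruct H2 as [y Hy]. apply imply_to_and in Hy.
  destruct Hx as [Hx Hfx], Hy as [Hy Hfy].
  assert (Nx := Hn x Hx). assert (Ny := Hn y Hy).
  destruct (IVT_gen f x y 0) as (w & Hw & E).
  - intros t. apply continuous_pt, Hc.
  - split; [eapply Rle_trans; [apply Rmin_l|]; lra|eapply Rle_trans; [|apply Rmax_r]; lra].
  - apply (Hn w); auto. revert Hw. unfold Rmin, Rmax. destruct (Rle_dec x y); lra.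
Qed.

Lemma pair_ratio_derive (W V : R -> R) (t : R) : affine_pair W V -> W t <> 0 ->
  is_derive (fun t => V t / W t) t (- / W t).
Proof.
  intros (HW & HV & Hb & _) Ht.
  assert (E1 := C1_field_derive W t HW). assert (E2 := C1_field_derive V t HV).
  evar_last; [apply is_derive_div; eauto|]. generalize (Hb t). unfold bracket. intros E.
  replace (Derive V t * W t - V t * Derive W t) with (- W t) by lra. field. auto.
Qed.

Lemma C1_field_right (w : R -> R) (a B : R) : C1_field w -> w a = 0 -> Derive w a < B ->
  exists r, 0 < r /\ forall t, a < t < a + r -> Derive w t < B /\ w t < B * (t - a).
Proof.
  intros Hw Ha HB.
  destruct (proj1 (continuous_R _ _) (C1_field_cont_D w a Hw) (B - Derive w a)) as (r & Hr & H);
    [lra|].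
  exists r. split; auto. intros t Ht.
  assert (HD : forall x, a < x < a + r -> Derive w x < B).
  { intros x Hx. assert (Hx' : Rabs (x - a) < r) by (apply Rabs_def1; lra).
    apply H, Rabs_def2 in Hx'. lra. }
  split; auto.
  destruct (MVT_R w (Derive w) a t (proj1 Ht)) as (c & Hc & E).
  - intros; apply C1_field_derive, Hw.
  - intros; apply C1_field_cont, Hw.
  - rewrite Ha, Rminus_0_r in E. rewrite E. apply Rmult_lt_compat_r; [lra|]. apply HD. lra.
Qed.

(** W vanishes at [a], so W < C (t - a) just after it, and (V/W)' = - 1/W is below - 1 / (C (t -
    a)). Hence V/W + ln (t - a) / C does not increase, and the logarithm drives V/W to plus infinity
    as t approaches [a]. *)
Lemma ratio_right_pos (W V : R -> R) (a d A : R) : affine_pair W V -> W a = 0 -> 0 < d ->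
  (forall t, a < t < a + d -> 0 < W t) ->
  exists r, 0 < r <= d /\ forall t, a < t < a + r -> A < V t / W t.
Proof.
  intros HP Ha Hd Hpos. destruct HP as (HW & HP').
  assert (HP : affine_pair W V) by (split; auto). clear HP'.
  set (C := Rabs (Derive W a) + 1).
  assert (HC : 0 < C) by (unfold C; generalize (Rabs_pos (Derive W a)); lra).
  destruct (C1_field_right W a C HW Ha) as (r & Hr & H).
  { unfold C. generalize (Rle_abs (Derive W a)). lra. }
  set (m := Rmin r d). assert (Hm : 0 < m) by (apply Rmin_pos; auto).
  assert (Hmr : m <= r) by apply Rmin_l. assert (Hmd : m <= d) by apply Rmin_r.
  set (phi := fun t => V t / W t + / C * ln (t - a)).
  assert (Hphi : forall t, a < t < a + m -> is_derive phi t (- / W t + / C * / (t - a))).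
  { intros t Ht. apply (is_derive_plus (fun t => V t / W t) (fun t => / C * ln (t - a))).
    - apply pair_ratio_derive; auto. apply Rgt_not_eq, Hpos. lra.
    - apply is_derive_scal. auto_derive; [lra|]. field. lra. }
  set (p := phi (a + m / 2)).
  (* Within the second radius ln (t - a) / C < p - A, so [p <= phi t] gives V/W > A. *)
  exists (Rmin (m / 2) (exp (C * (p - A)))). split.
  { split; [apply Rmin_pos; [lra|apply exp_pos]|].
    eapply Rle_trans; [apply Rmin_l|lra]. }
  intros t Ht.
  assert (Ht1 : t < a + m / 2) by (generalize (Rmin_l (m / 2) (exp (C * (p - A)))); lra).
  assert (Ht2 : t - a < exp (C * (p - A))) by (generalize (Rmin_r (m / 2) (exp (C * (p - A)))); lra).
  apply ln_increasing in Ht2; [|lra]. rewrite ln_exp in Ht2.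
  assert (Hle : p <= phi t).
  { unfold p. apply (decr_of_derive phi _ a (a + m) Hphi); try lra.
    intros x Hx. destruct (H x) as [_ Hx']; [lra|].
    assert (0 < W x) by (apply Hpos; lra).
    rewrite <- Rinv_mult.
    assert (/ (C * (x - a)) < / W x) by (apply Rinv_lt_contravar; nra). lra. }
  unfold phi in Hle.
  assert (/ C * ln (t - a) < p - A).
  { apply (Rmult_lt_reg_l C); auto. rewrite <- Rmult_assoc, Rinv_r, Rmult_1_l; lra. }
  lra.
Qed.

(* (t - a) V^2 / W decreases to the right of a, since V' stays below 1/2 there. *)
Lemma flat_right_pos (W V : R -> R) (a d e : R) : affine_pair W V -> W a = 0 ->
  Derive V a = 0 -> 0 < d -> 0 < e -> (forall t, a < t < a + d -> 0 < W t) ->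
  exists r, 0 < r /\ forall t, a < t < a + r -> W t < e * (V t * V t).
Proof.
  intros HP Ha HDa Hd He Hpos. assert (HVa := pair_zero W V a HP Ha).
  generalize HP; intros (HW & HV & Hb & _).
  destruct (ratio_right_pos W V a d 0 HP Ha Hd Hpos) as (r1 & Hr1 & H1).
  (* With V' < 1/2 and V < (t - a)/2, the factor (V' - 1)(t - a) + V of the derivative of [psi] is
     at most (- 1/2 + 1/2)(t - a) = 0. *)
  destruct (C1_field_right V a (/ 2) HV HVa) as (r2 & Hr2 & H2); [lra|].
  set (m := Rmin r1 r2). assert (Hm : 0 < m) by (apply Rmin_pos; lra).
  assert (Hm1 : m <= r1) by apply Rmin_l. assert (Hm2 : m <= r2) by apply Rmin_r.
  assert (Hp : forall t, a < t < a + m -> 0 < W t /\ 0 < V t).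
  { intros t Ht. assert (HWt : 0 < W t) by (apply Hpos; lra). split; auto.
    replace (V t) with (V t / W t * W t) by (field; lra). apply Rmult_lt_0_compat; auto.
    apply H1. lra. }
  set (psi := fun t => (t - a) * (V t * (V t / W t))).
  assert (Hpsi : forall t, a < t < a + m ->
    is_derive psi t (V t / W t * ((Derive V t - 1) * (t - a) + V t))).
  { intros t Ht. destruct (Hp t Ht) as [HWt HVt].
    replace (V t / W t * ((Derive V t - 1) * (t - a) + V t)) with
      (1 * (V t * (V t / W t)) + (t - a) * (Derive V t * (V t / W t) + V t * (- / W t)))
      by (field; lra).
    apply (is_derive_mult (fun t => t - a) (fun t => V t * (V t / W t))).
    - auto_derive; auto; ring.
    - apply (is_derive_mult V (fun t => V t / W t)).
      + apply C1_field_derive, HV.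
      + apply pair_ratio_derive; auto. lra.
      + intros; apply Rmult_comm.
    - intros; apply Rmult_comm. }
  set (p := psi (a + m / 2)).
  assert (Hp0 : 0 < p).
  { unfold p, psi. destruct (Hp (a + m / 2)) as [HWt HVt]; [lra|].
    apply Rmult_lt_0_compat; [lra|]. apply Rmult_lt_0_compat; auto.
    apply Rdiv_lt_0_compat; auto. }
  (* [p <= psi t] means W <= (t - a) V^2 / p, which is below e V^2 as soon as t - a < p e. *)
  exists (Rmin (m / 2) (p * e)). split.
  { apply Rmin_pos; [lra|]. apply Rmult_lt_0_compat; auto. }
  intros t Ht.
  assert (Ht1 : t < a + m / 2) by (generalize (Rmin_l (m / 2) (p * e)); lra).
  assert (Ht2 : t - a < p * e) by (generalize (Rmin_r (m / 2) (p * e)); lra).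
  destruct (Hp t) as [HWt HVt]; [lra|].
  assert (Hle : p <= psi t).
  { unfold p. apply (decr_of_derive psi _ a (a + m) Hpsi); try lra.
    intros x Hx. destruct (H2 x) as [Hx1 Hx2]; [lra|]. destruct (Hp x Hx) as [HWx HVx].
    assert (0 < V x / W x) by (apply Rdiv_lt_0_compat; auto).
    assert ((Derive V x - 1) * (x - a) <= (/ 2 - 1) * (x - a)) by (apply Rmult_le_compat_r; lra).
    assert ((Derive V x - 1) * (x - a) + V x <= 0) by lra.
    rewrite <- (Rmult_0_r (V x / W x)). apply Rmult_le_compat_l; lra. }
  unfold psi in Hle. assert (0 < V t * V t) by nra.
  assert (p * W t <= (t - a) * (V t * V t)).
  { replace ((t - a) * (V t * V t)) with ((t - a) * (V t * (V t / W t)) * W t) by (field; lra).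
    apply Rmult_le_compat_r; lra. }
  assert (p * W t < p * (e * (V t * V t))) by nra.
  apply (Rmult_lt_reg_l p); auto.
Qed.

Lemma pair_right (W V : R -> R) (a A : R) : affine_pair W V -> W a = 0 ->
  exists r, 0 < r /\ forall t, a < t < a + r -> A < V t / Rabs (W t).
Proof.
  intros HP Ha. destruct (pair_zeros_isolated W V a HP Ha) as (d & Hd & Hi).
  assert (Hn : forall t, a < t < a + d -> W t <> 0).
  { intros t Ht. apply Hi; [lra|]. apply Rabs_def1; lra. }
  destruct (nonzero_sign W a (a + d)) as [Hs|Hs]; auto.
  { intros t. apply C1_field_cont, HP. }
  - destruct (ratio_right_pos W V a d A HP Ha Hd Hs) as (r & Hr & H).
    exists r. split; [lra|]. intros t Ht. rewrite Rabs_pos_eq; auto.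
    apply Rlt_le, Hs. lra.
  - destruct (ratio_right_pos (fun t => - W t) V a d A) as (r & Hr & H); auto.
    + apply pair_opp, HP.
    + lra.
    + intros t Ht. specialize (Hs t Ht). lra.
    + exists r. split; [lra|]. intros t Ht. rewrite Rabs_left; auto. apply Hs. lra.
Qed.

Lemma pair_left (W V : R -> R) (a A : R) : affine_pair W V -> W a = 0 ->
  exists r, 0 < r /\ forall t, a - r < t < a -> V t / Rabs (W t) < A.
Proof.
  intros HP Ha.
  destruct (pair_right _ _ (- a) (- A) (pair_reflect W V HP)) as (r & Hr & H).
  - simpl. rewrite Ropp_involutive. lra.
  - exists r. split; auto. intros t Ht. specialize (H (- t) ltac:(lra)). simpl in H.
    rewrite Ropp_involutive, Rabs_Ropp in H. unfold Rdiv in *. lra.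
Qed.

Lemma pair_flat_right (W V : R -> R) (a e : R) : affine_pair W V -> W a = 0 ->
  Derive V a = 0 -> 0 < e ->
  exists r, 0 < r /\ forall t, a < t < a + r -> Rabs (W t) < e * (V t * V t).
Proof.
  intros HP Ha HD He. destruct (pair_zeros_isolated W V a HP Ha) as (d & Hd & Hi).
  assert (Hn : forall t, a < t < a + d -> W t <> 0).
  { intros t Ht. apply Hi; [lra|]. apply Rabs_def1; lra. }
  destruct (nonzero_sign W a (a + d)) as [Hs|Hs]; auto.
  { intros t. apply C1_field_cont, HP. }
  - destruct (flat_right_pos W V a d e HP Ha HD Hd He Hs) as (r & Hr & H).
    exists (Rmin r d). split; [apply Rmin_pos; auto|]. intros t Ht.
    generalize (Rmin_l r d) (Rmin_r r d); intros. rewrite Rabs_pos_eq; [apply H; lra|].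
    apply Rlt_le, Hs. lra.
  - destruct (flat_right_pos (fun t => - W t) V a d e) as (r & Hr & H); auto.
    + apply pair_opp, HP.
    + lra.
    + intros t Ht. specialize (Hs t Ht). lra.
    + exists (Rmin r d). split; [apply Rmin_pos; auto|]. intros t Ht.
      generalize (Rmin_l r d) (Rmin_r r d); intros. rewrite Rabs_left; [apply H; lra|].
      apply Hs. lra.
Qed.

(** At a flat zero W is o(V^2). This is the estimate that makes [density] tend to 0 there. *)
Lemma pair_flat (W V : R -> R) (a e : R) : affine_pair W V -> W a = 0 ->
  Derive V a = 0 -> 0 < e ->
  exists r, 0 < r /\ forall t, t <> a -> Rabs (t - a) < r -> Rabs (W t) < e * (V t * V t).
Proof.
  intros HP Ha HD He.
  destruct (pair_flat_right W V a e HP Ha HD He) as (r1 & Hr1 & H1).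
  destruct (pair_flat_right _ _ (- a) e (pair_reflect W V HP)) as (r2 & Hr2 & H2); auto.
  { simpl. rewrite Ropp_involutive. lra. }
  { rewrite (proj2 (field_reflect V (proj1 (proj2 HP)))), Ropp_involutive. auto. }
  exists (Rmin r1 r2). split; [apply Rmin_pos; auto|]. intros t Hn Ht.
  generalize (Rmin_l r1 r2) (Rmin_r r1 r2); intros. apply Rabs_def2 in Ht.
  destruct (Rtotal_order a t) as [Hl|[Hl|Hl]]; [apply H1; lra|exfalso; auto|].
  specialize (H2 (- t) ltac:(lra)). simpl in H2. rewrite Ropp_involutive, Rabs_Ropp in H2.
  nra.
Qed.

(** * Rectification *)

(* The derivative of (2/N) arccot (N V / |W|); at a common zero of V and W
   division by zero gives the correct limit 0. *)
Definition density (N : R) (W V : R -> R) (t : R) : R :=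
  2 * Rabs (W t) / (W t * W t + N * N * (V t * V t)).

Lemma density_den (N w v : R) : w <> 0 -> 0 < w * w + N * N * (v * v).
Proof.
  intros Hw. assert (0 < w * w) by nra.
  assert (0 <= (N * v) * (N * v)) by apply Rle_0_sqr. nra.
Qed.

Lemma density_pos (N : R) (W V : R -> R) t : W t <> 0 -> 0 < density N W V t.
Proof.
  intros H. unfold density. apply Rdiv_lt_0_compat; [|apply density_den, H].
  generalize (Rabs_pos_lt _ H). lra.
Qed.

Lemma density_zero (N : R) (W V : R -> R) t : W t = 0 -> density N W V t = 0.
Proof. intros H. unfold density. rewrite H, Rabs_R0. unfold Rdiv. ring. Qed.

Lemma density_ge0 (N : R) (W V : R -> R) t : 0 <= density N W V t.
Proof.
  destruct (Req_dec (W t) 0) as [E|E]; [rewrite density_zero; auto; lra|].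
  apply Rlt_le, density_pos, E.
Qed.

Lemma density_cont (N : R) (W V : R -> R) t : 0 < N -> affine_pair W V ->
  (forall a, W a = 0 -> Derive V a = 0) -> continuous (density N W V) t.
Proof.
  intros HN HP HD.
  assert (HW : forall t, continuous W t) by (intros; apply C1_field_cont, HP).
  assert (HV : forall t, continuous V t) by (intros; apply C1_field_cont, HP).
  destruct (Req_dec (W t) 0) as [E|E].
  - apply continuous_R. rewrite density_zero by auto. intros e He.
    (* The constant is chosen so that 2 |W| < e N^2 V^2, whence the density is below e. *)
    destruct (pair_flat W V t (e * (N * N) / 2) HP E (HD t E)) as (r & Hr & H).
    { assert (0 < N * N) by nra. nra. }
    exists r. split; auto. intros y Hy. rewrite Rminus_0_r.
    rewrite Rabs_pos_eq by apply density_ge0.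
    destruct (Req_dec (W y) 0) as [E'|E']; [rewrite density_zero; auto|].
    specialize (H y). unfold density. assert (Hd := density_den N (W y) (V y) E').
    apply (Rmult_lt_reg_r (W y * W y + N * N * (V y * V y))); auto.
    unfold Rdiv. rewrite Rmult_assoc, Rinv_l, Rmult_1_r by lra.
    assert (Hyt : y <> t) by (intros ->; auto). specialize (H Hyt Hy).
    assert (0 < W y * W y) by nra. nra.
  - unfold density, Rdiv.
    apply (continuous_mult (fun t => 2 * Rabs (W t))
       (fun t => / (W t * W t + N * N * (V t * V t)))).
    + apply (continuous_scal_r (V := R_NormedModule) 2 (fun t => Rabs (W t))).
      apply continuous_Rabs_comp, HW.
    + apply continuous_Rinv_comp; [|generalize (density_den N (W t) (V t) E); lra].
      apply (continuous_plus (fun t => W t * W t) (fun t => N * N * (V t * V t))).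
      * apply (continuous_mult W W); auto.
      * apply (continuous_scal_r (V := R_NormedModule) (N * N) (fun t => V t * V t)).
        apply (continuous_mult V V); auto.
Qed.

Lemma atan_near_right (e : R) : 0 < e -> exists A, forall x, A < x -> PI / 2 - e < atan x.
Proof.
  intros He. assert (HP := PI_RGT_0). set (y := Rmax 0 (PI / 2 - e / 2)).
  assert (Hy : 0 <= y < PI / 2) by (unfold y; split; [apply Rmax_l|apply Rmax_lub_lt; lra]).
  assert (Hy' : PI / 2 - e / 2 <= y) by apply Rmax_r.
  exists (tan y). intros x Hx. apply atan_increasing in Hx.
  rewrite atan_tan in Hx by lra. lra.
Qed.

Lemma eq_of_close (x y : R) : (forall e, 0 < e -> Rabs (x - y) < e) -> x = y.
Proof.
  intros H. apply Rminus_diag_uniq. apply NNPP. intros Hn.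
  specialize (H _ (Rabs_pos_lt _ Hn)). lra.
Qed.

Lemma const_of_derive0 (f : R -> R) (a b x y : R) :
  (forall t, a < t < b -> is_derive f t 0) -> a < x < b -> a < y < b -> f x = f y.
Proof.
  intros H Hx Hy.
  assert (Hw : forall x y, a < x < b -> a < y < b -> x < y -> f x = f y).
  { intros u v Hu Hv Huv. destruct (MVT_R f (fun _ => 0) u v Huv) as (c & _ & E).
    - intros t Ht. apply H. lra.
    - intros t Ht. eapply is_derive_cont, H. lra.
    - lra. }
  destruct (Rtotal_order x y) as [Hl|[->|Hl]]; auto. symmetry. auto.
Qed.

Lemma cos_2atan x : cos (2 * atan x) = (1 - x * x) / (1 + x * x).
Proof.
  rewrite cos_2a, cos_atan, sin_atan.
  assert (H : 0 < 1 + x²) by (generalize (Rle_0_sqr x); lra).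
  assert (Hs : sqrt (1 + x²) * sqrt (1 + x²) = 1 + x²) by (apply sqrt_sqrt; lra).
  assert (Hp : 0 < sqrt (1 + x²)) by (apply sqrt_lt_R0; auto).
  unfold Rsqr in *. set (r := sqrt _) in *. rewrite <- Hs. field. lra.
Qed.

Lemma sin_2atan x : sin (2 * atan x) = 2 * x / (1 + x * x).
Proof.
  rewrite sin_2a, cos_atan, sin_atan.
  assert (H : 0 < 1 + x²) by (generalize (Rle_0_sqr x); lra).
  assert (Hs : sqrt (1 + x²) * sqrt (1 + x²) = 1 + x²) by (apply sqrt_sqrt; lra).
  assert (Hp : 0 < sqrt (1 + x²)) by (apply sqrt_lt_R0; auto).
  unfold Rsqr in *. set (r := sqrt _) in *. rewrite <- Hs. field. lra.
Qed.

Lemma gap_angle (W V F : R -> R) (N a b : R) : 0 < N -> affine_pair W V ->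
  (forall t, is_derive F t (density N W V t)) -> a < b -> W a = 0 -> W b = 0 ->
  (forall t, a < t < b -> W t <> 0) ->
  N * F b = N * F a + 2 * PI /\
  forall t, a < t < b -> N * F t = N * F a + PI - 2 * atan (N * (V t / Rabs (W t))).
Proof.
  intros HN HP HF Hab Ha Hb Hn.
  set (q := fun t => N * (V t / Rabs (W t))).
  set (h := fun t => N / 2 * F t + atan (q t)).
  assert (Hh : forall t, a < t < b -> is_derive h t 0).
  { intros t Ht. specialize (Hn t Ht).
    assert (HWc := C1_field_cont W t (proj1 HP)).
    assert (Hq : is_derive q t (- N / Rabs (W t))).
    { destruct (Rlt_le_dec 0 (W t)) as [Hs|Hs].
      - apply (is_derive_ext_loc (fun t => N * (V t / W t))).
        + apply locally_R.
          destruct (proj1 (continuous_R _ _) HWc (W t) Hs) as (d & Hd & H).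
          exists d. split; auto. intros y Hy. apply H, Rabs_def2 in Hy.
          unfold q. rewrite Rabs_pos_eq; [auto|lra].
        + rewrite Rabs_pos_eq by lra. replace (- N / W t) with (N * (- / W t)) by (field; auto).
          apply is_derive_scal, pair_ratio_derive; auto.
      - apply (is_derive_ext_loc (fun t => - N * (V t / W t))).
        + apply locally_R.
          destruct (proj1 (continuous_R _ _) HWc (- W t)) as (d & Hd & H); [lra|].
          exists d. split; auto. intros y Hy. apply H, Rabs_def2 in Hy.
          assert (E : - N * (V y / W y) = N * (V y / Rabs (W y)))
            by (rewrite Rabs_left by lra; field; lra).
          exact E.
        + rewrite Rabs_left by lra.
          replace (- N / - W t) with (- N * (- / W t)) by (field; auto).
          apply is_derive_scal, pair_ratio_derive; auto. }
    replace 0 with (N / 2 * density N W V t + (- N / Rabs (W t)) * / (1 + (q t)²)).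
    - apply (is_derive_plus (fun t => N / 2 * F t) (fun t => atan (q t))).
      + apply is_derive_scal, HF.
      + apply (is_derive_comp atan q); [apply is_derive_atan|exact Hq].
    - unfold density, q, Rsqr. assert (Hr := Rabs_pos_lt _ Hn).
      assert (E : W t * W t = Rabs (W t) * Rabs (W t)).
      { rewrite <- Rabs_mult. symmetry. apply Rabs_pos_eq, Rle_0_sqr. }
      rewrite E. set (w := Rabs (W t)) in *.
      assert (Hd := density_den N w (V t) (Rgt_not_eq _ _ Hr)).
      field. repeat split; try lra; nra. }
  set (k := h ((a + b) / 2)).
  assert (Hk : forall t, a < t < b -> h t = k).
  { intros t Ht. unfold k. apply (const_of_derive0 h a b); auto; lra. }
  assert (HFc : forall t, continuous (fun t => N / 2 * F t) t).
  { intros t. apply (continuous_scal_r (V := R_NormedModule)). eapply is_derive_cont, HF. }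
  (* The constant is identified by letting t tend to the endpoint: F is continuous there and the
     arctangent tends to PI / 2. *)
  assert (Ka : k = N / 2 * F a + PI / 2).
  { apply eq_of_close. intros e He.
    destruct (atan_near_right (e / 2)) as [A HA]; [lra|].
    destruct (pair_right W V a (A / N) HP Ha) as (r1 & Hr1 & H1).
    destruct (proj1 (continuous_R _ _) (HFc a) (e / 2)) as (r2 & Hr2 & H2); [lra|].
    set (m := Rmin (b - a) (Rmin r1 r2)).
    assert (Hm : 0 < m) by (repeat apply Rmin_pos; lra).
    assert (Hm1 : m <= b - a) by apply Rmin_l.
    assert (Hm2 : m <= r1) by (eapply Rle_trans; [apply Rmin_r|apply Rmin_l]).
    assert (Hm3 : m <= r2) by (eapply Rle_trans; [apply Rmin_r|apply Rmin_r]).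
    rewrite <- (Hk (a + m / 2)) by lra. unfold h.
    specialize (H1 (a + m / 2) ltac:(lra)).
    assert (Hq : A < q (a + m / 2)).
    { unfold q. apply (Rmult_lt_compat_l N) in H1; auto.
      replace (N * (A / N)) with A in H1 by (field; lra). exact H1. }
    apply HA in Hq. destruct (atan_bound (q (a + m / 2))) as [_ Hq2].
    assert (Hx : Rabs (a + m / 2 - a) < r2) by (apply Rabs_def1; lra).
    apply H2, Rabs_def2 in Hx. apply Rabs_def1; lra. }
  assert (Kb : k = N / 2 * F b - PI / 2).
  { apply eq_of_close. intros e He.
    destruct (atan_near_right (e / 2)) as [A HA]; [lra|].
    destruct (pair_left W V b (- A / N) HP Hb) as (r1 & Hr1 & H1).
    destruct (proj1 (continuous_R _ _) (HFc b) (e / 2)) as (r2 & Hr2 & H2); [lra|].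
    set (m := Rmin (b - a) (Rmin r1 r2)).
    assert (Hm : 0 < m) by (repeat apply Rmin_pos; lra).
    assert (Hm1 : m <= b - a) by apply Rmin_l.
    assert (Hm2 : m <= r1) by (eapply Rle_trans; [apply Rmin_r|apply Rmin_l]).
    assert (Hm3 : m <= r2) by (eapply Rle_trans; [apply Rmin_r|apply Rmin_r]).
    rewrite <- (Hk (b - m / 2)) by lra. unfold h.
    specialize (H1 (b - m / 2) ltac:(lra)).
    assert (Hq : A < - q (b - m / 2)).
    { unfold q. apply (Rmult_lt_compat_l N) in H1; auto.
      replace (N * (- A / N)) with (- A) in H1 by (field; lra). lra. }
    apply HA in Hq. rewrite atan_opp in Hq. destruct (atan_bound (q (b - m / 2))) as [Hq2 _].
    assert (Hx : Rabs (b - m / 2 - b) < r2) by (apply Rabs_def1; lra).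
    apply H2, Rabs_def2 in Hx. apply Rabs_def1; lra. }
  split; [lra|]. intros t Ht. specialize (Hk t Ht). unfold h in Hk. fold (q t). lra.
Qed.

(** The last clause says that F carries |W| to 1 - cos (n theta) and V to sin (n theta) / n. It
    comes from the half-angle formulas: with x = n V/|W|, one has 1 - cos (n F) = 2 / (1 + x^2) and
    sin (n F) = 2 x / (1 + x^2). *)
Lemma rectify (W V : R -> R) (n : nat) (z : nat -> R) :
  affine_pair W V -> zero_chain W n z -> (forall k, (k < n)%nat -> Derive V (z k) = 0) ->
  exists F : R -> R, circle_lift F /\ (forall x y, x < y -> F x < F y) /\
    (forall t, is_derive F t (density (INR n) W V t)) /\
    (forall t, continuous (density (INR n) W V) t) /\
    (forall k, (k <= n)%nat -> F (z k) = 2 * PI * INR k / INR n) /\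
    forall t, 1 - cos (INR n * F t) = Rabs (W t) * density (INR n) W V t /\
              sin (INR n * F t) = INR n * (V t * density (INR n) W V t).
Proof.
  intros HP Hz HDz.
  assert (Hz' := Hz). destruct Hz' as (Hn1 & Hzn & Hz0 & Hgap).
  assert (HN : 0 < INR n) by (apply lt_0_INR; lia).
  assert (HpW : periodic W) by apply HP. assert (HpV : periodic V) by apply HP.
  set (f := density (INR n) W V).
  assert (HD : forall a, W a = 0 -> Derive V a = 0).
  { intros a Ha. destruct (zero_chain_zero W n z a HpW Hz Ha) as (k & Hk & i & E).
    rewrite <- (HDz k Hk), E. symmetry. apply periodic_Z, Derive_periodic, HpV. }
  assert (Hfc : forall t, continuous f t) by (intros; apply density_cont; auto).
  pose (F := (fun t => RInt f (z 0%nat) t) : R -> R).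
  assert (HF : forall t, is_derive F t (f t)).
  { intros t. apply (is_derive_RInt f F (z 0%nat) t); [|apply Hfc].
    apply filter_forall. intros u. apply (RInt_correct (V := R_CompleteNormedModule)).
    apply (ex_RInt_continuous (V := R_CompleteNormedModule)). intros; apply Hfc. }
  assert (HF0 : F (z 0%nat) = 0) by (unfold F; apply (RInt_point (V := R_CompleteNormedModule))).
  assert (HFk : forall k, (k <= n)%nat -> INR n * F (z k) = 2 * PI * INR k).
  { induction k as [|k IH]; intros Hk.
    - rewrite HF0. simpl. ring.
    - destruct (Hgap k) as [H1 H2]; [lia|].
      destruct (gap_angle W V F (INR n) (z k) (z (S k)) HN HP HF H1
        (Hz0 k ltac:(lia)) (Hz0 (S k) ltac:(lia)) H2) as [E _].
      rewrite E, IH, S_INR by lia. ring. }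
  assert (Hlift : circle_lift F).
  { intros t.
    assert (Hd : forall u, is_derive (fun t => F (t + 2 * PI) - F t) u 0).
    { intros u. replace 0 with (1 * f (u + 2 * PI) - f u).
      - apply (is_derive_minus (fun t => F (t + 2 * PI)) F); [|apply HF].
        apply (is_derive_comp F (fun t => t + 2 * PI)); [apply HF|].
        auto_derive; auto; ring.
      - unfold f, density. rewrite HpW, HpV. ring. }
    assert (E : F (t + 2 * PI) - F t = F (z 0%nat + 2 * PI) - F (z 0%nat)).
    { apply (const_of_derive0 (fun t => F (t + 2 * PI) - F t)
        (Rmin t (z 0%nat) - 1) (Rmax t (z 0%nat) + 1)); auto;
      generalize (Rmin_l t (z 0%nat)) (Rmin_r t (z 0%nat)) (Rmax_l t (z 0%nat))
        (Rmax_r t (z 0%nat)); lra. }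
    rewrite <- Hzn, HF0 in E. generalize (HFk n (Nat.le_refl n)). intros E2.
    assert (F (z n) = 2 * PI) by (apply (Rmult_eq_reg_l (INR n)); lra). lra. }
  assert (Hmono : forall x y, x <= y -> F x <= F y).
  { intros x y [Hxy| ->]; [|lra].
    destruct (MVT_R F f x y Hxy (fun t _ => HF t)) as (c & _ & E).
    - intros t _. eapply is_derive_cont, HF.
    - assert (0 <= f c) by apply density_ge0. nra. }
  (* F' vanishes at the zeros of W. If F x = F y, monotonicity makes F constant on the interval, so
     W would vanish on all of it. *)
  assert (Hincr : forall x y, x < y -> F x < F y).
  { intros x y Hxy. destruct (Hmono x y) as [|E]; [lra|auto|]. exfalso.
    destruct HP as (_ & _ & _ & Hno). apply (Hno x y Hxy). intros t Ht. apply NNPP. intros Hnt.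
    assert (Hpos := density_pos (INR n) W V t Hnt). fold f in Hpos.
    assert (H0 : is_derive F t 0).
    { apply (is_derive_ext_loc (fun _ => F x)).
      - apply locally_R. exists (Rmin (t - x) (y - t)). split; [apply Rmin_pos; lra|].
        intros u Hu. generalize (Rmin_l (t - x) (y - t)) (Rmin_r (t - x) (y - t)). intros.
        apply Rabs_def2 in Hu.
        assert (F x <= F u) by (apply Hmono; lra). assert (F u <= F y) by (apply Hmono; lra).
        apply Rle_antisym; lra.
      - apply (is_derive_const (V := R_NormedModule)). }
    apply is_derive_unique in H0. rewrite (is_derive_unique _ _ _ (HF t)) in H0. lra. }
  exists F. split; [auto|split; [auto|split; [auto|split; [auto|split]]]].
  { intros k Hk. rewrite <- HFk by auto. field. lra. }
  assert (Hbase : forall t, z 0%nat <= t < z n ->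
    1 - cos (INR n * F t) = Rabs (W t) * f t /\ sin (INR n * F t) = INR n * (V t * f t)).
  { intros t Ht. destruct (zero_chain_locate W n z t Hz Ht) as (k & Hk & Htk).
    destruct (Hgap k Hk) as [H1 H2].
    destruct (Req_dec t (z k)) as [->|Hne].
    - rewrite HFk by lia. unfold f. rewrite density_zero by (apply Hz0; lia).
      replace (2 * PI * INR k) with (0 + 2 * INR k * PI) by ring.
      rewrite cos_period, sin_period, cos_0, sin_0. lra.
    - assert (Htk' : z k < t < z (S k)) by lra. assert (Hnt := H2 t Htk').
      destruct (gap_angle W V F (INR n) (z k) (z (S k)) HN HP HF H1
        (Hz0 k ltac:(lia)) (Hz0 (S k) ltac:(lia)) H2) as [_ E].
      rewrite E, HFk by (auto; lia). set (q := INR n * (V t / Rabs (W t))).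
      replace (2 * PI * INR k + PI - 2 * atan q) with (PI - 2 * atan q + 2 * INR k * PI) by ring.
      rewrite cos_period, sin_period, sin_PI_x.
      replace (PI - 2 * atan q) with (- (2 * atan q) + PI) by ring.
      rewrite neg_cos, cos_neg, cos_2atan, sin_2atan.
      assert (Hr := Rabs_pos_lt _ Hnt).
      assert (E' : W t * W t = Rabs (W t) * Rabs (W t)).
      { rewrite <- Rabs_mult. symmetry. apply Rabs_pos_eq, Rle_0_sqr. }
      unfold f, density, q. rewrite E'. set (w := Rabs (W t)) in *.
      assert (Hd := density_den (INR n) w (V t) (Rgt_not_eq _ _ Hr)).
      split; field; repeat split; try lra; nra. }
  intros t. destruct (shift_into (z 0%nat) t) as [i Hi].
  destruct (Hbase (t + 2 * PI * IZR i)) as [E1 E2]; [lra|].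
  rewrite circle_lift_Z in E1, E2 by auto.
  assert (Hpf : periodic f) by (intros u; unfold f, density; rewrite HpW, HpV; auto).
  rewrite (periodic_Z W), (periodic_Z f) in E1 by auto.
  rewrite (periodic_Z V), (periodic_Z f) in E2 by auto.
  assert (Hcos : periodic cos) by (intros u; rewrite cos_plus, cos_2PI, sin_2PI; ring).
  assert (Hsin : periodic sin) by (intros u; rewrite sin_plus, cos_2PI, sin_2PI; ring).
  (* Since [n] is an integer, whole turns of F remain whole turns of n F. *)
  replace (INR n * (F t + 2 * PI * IZR i)) with (INR n * F t + 2 * PI * IZR (Z.of_nat n * i))
    in E1, E2 by (rewrite mult_IZR, <- INR_IZR_INZ; ring).
  rewrite (periodic_Z cos) in E1 by auto. rewrite (periodic_Z sin) in E2 by auto. auto.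
Qed.

(** * The normal form *)

Lemma Rabs_mult_le (a b : R) : Rabs a <= 1 -> Rabs (a * b) <= Rabs b.
Proof. intros H. rewrite Rabs_mult. generalize (Rabs_pos b). nra. Qed.

(** The sign may jump only where [g] has a double zero: there a bounded factor leaves the slopes
    tending to 0. This is why independent signs between the zeros of 1 - cos (n theta) keep the
    field differentiable. *)
Lemma signed_derive (s g : R -> R) (t d : R) :
  (forall y, Rabs (s y) <= 1) -> is_derive g t d ->
  (locally t (fun y => s y = s t) \/ (g t = 0 /\ d = 0)) ->
  is_derive (fun y => s y * g y) t (s t * d).
Proof.
  intros Hs Hg [Hl|[E0 Ed]].
  - apply (is_derive_ext_loc (fun y => s t * g y)).
    + refine (filter_imp _ _ _ Hl). intros y ->. reflexivity.
    + apply is_derive_scal, Hg.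
  - apply is_derive_slope. apply is_derive_slope in Hg. rewrite E0, Ed in *.
    rewrite is_lim_R in *. intros e He. destruct (Hg e He) as (r & Hr & H).
    exists r. split; auto. intros y Hn Hy. specialize (H y Hn Hy).
    rewrite !Rminus_0_r in H. rewrite Rmult_0_r, !Rminus_0_r.
    unfold Rdiv in *. rewrite Rmult_assoc.
    eapply Rle_lt_trans; [apply Rabs_mult_le, Hs|exact H].
Qed.

Lemma signed_cont (s g : R -> R) (t : R) :
  (forall y, Rabs (s y) <= 1) -> continuous g t ->
  (locally t (fun y => s y = s t) \/ g t = 0) -> continuous (fun y => s y * g y) t.
Proof.
  intros Hs Hg [Hl|E0].
  - apply (continuous_ext_loc _ (fun y => s t * g y)).
    + refine (filter_imp _ _ _ Hl). intros y ->. reflexivity.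
    + apply (continuous_scal_r (V := R_NormedModule)), Hg.
  - rewrite continuous_R in *. rewrite E0 in *. intros e He.
    destruct (Hg e He) as (r & Hr & H). exists r. split; auto. intros y Hy.
    specialize (H y Hy). rewrite Rminus_0_r in H. rewrite Rmult_0_r, Rminus_0_r.
    eapply Rle_lt_trans; [apply Rabs_mult_le, Hs|exact H].
Qed.

Lemma sin_of_cos1 x : cos x = 1 -> sin x = 0.
Proof. intros E. generalize (sin2_cos2 x). rewrite E. unfold Rsqr. intros. nra. Qed.

(** The relation is linear in W, so a locally constant factor does not affect it; the rest is sin^2
    - cos (1 - cos) = 1 - cos. The bound on |s| replaces s = 1 or -1 because the [s] used later is 0
    at the nodes. *)
Lemma normal_form_pair (n : nat) (s : R -> R) : (1 <= n)%nat -> periodic s ->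
  (forall t, Rabs (s t) <= 1) ->
  (forall t, cos (INR n * t) <> 1 -> s t <> 0 /\ locally t (fun y => s y = s t)) ->
  affine_pair (fun t => s t * (1 - cos (INR n * t))) (fun t => 1 / INR n * sin (INR n * t)).
Proof.
  intros Hn Hps Hs Hloc. assert (HN : 0 < INR n) by (apply lt_0_INR; lia).
  set (N := INR n) in *.
  assert (Hshift : forall t, N * (t + 2 * PI) = N * t + 2 * PI * IZR (Z.of_nat n)).
  { intros t. rewrite <- INR_IZR_INZ. fold N. ring. }
  assert (Hcos : periodic cos) by (intros u; rewrite cos_plus, cos_2PI, sin_2PI; ring).
  assert (Hsin : periodic sin) by (intros u; rewrite sin_plus, cos_2PI, sin_2PI; ring).
  assert (HdW : forall t, is_derive (fun t => s t * (1 - cos (N * t))) t (s t * (N * sin (N * t)))).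
  { intros t. apply (signed_derive s (fun t => 1 - cos (N * t))); auto.
    - auto_derive; auto. ring.
    - destruct (Req_dec (cos (N * t)) 1) as [E|E]; [right|left; apply Hloc, E].
      rewrite E, sin_of_cos1 by auto. lra. }
  assert (HdV : forall t, is_derive (fun t => 1 / N * sin (N * t)) t (cos (N * t))).
  { intros t. auto_derive; auto. field. lra. }
  split; [|split; [|split]].
  - apply C1_field_of with (fun t => s t * (N * sin (N * t))); auto.
    + intros t. rewrite Hps, Hshift, periodic_Z by auto. auto.
    + intros t. apply (signed_cont s (fun t => N * sin (N * t))); auto.
      * apply (ex_derive_continuous (fun t => N * sin (N * t))). auto_derive. auto.
      * destruct (Req_dec (cos (N * t)) 1) as [E|E]; [right|left; apply Hloc, E].
        rewrite sin_of_cos1 by auto. ring.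
  - apply C1_field_of with (fun t => cos (N * t)); auto.
    + intros t. rewrite Hshift, periodic_Z by auto. auto.
    + intros t. apply (ex_derive_continuous (fun t => cos (N * t))). auto_derive. auto.
  - intros t. unfold bracket.
    assert (EW : Derive (fun t : R => s t * (1 - cos (N * t))) t = s t * (N * sin (N * t)))
      by apply is_derive_unique, HdW.
    assert (EV : Derive (fun t : R => 1 / N * sin (N * t)) t = cos (N * t))
      by apply is_derive_unique, HdV.
    rewrite EW, EV. clear EW EV.
    assert (E := sin2_cos2 (N * t)). unfold Rsqr in E.
    replace (1 / N * sin (N * t) * (s t * (N * sin (N * t)))) with
      (s t * (sin (N * t) * sin (N * t))) by (field; lra).
    replace (sin (N * t) * sin (N * t)) with (1 - cos (N * t) * cos (N * t)) by lra. ring.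
  - intros a b Hab H.
    assert (Hc : forall t, a < t < b -> cos (N * t) = 1).
    { intros t Ht. apply NNPP. intros Hne. destruct (Hloc t Hne) as [Hs0 _].
      specialize (H t Ht). apply Rmult_integral in H. destruct H; [auto|lra]. }
    assert (Hz : forall t, a < t < b -> sin (N * t) = 0) by (intros; apply sin_of_cos1; auto).
    set (t := (a + b) / 2). assert (Ht : a < t < b) by (unfold t; lra).
    assert (H0 : is_derive (fun t => sin (N * t)) t 0).
    { apply (is_derive_ext_loc (fun _ => 0)); [|apply (is_derive_const (V := R_NormedModule))].
      apply locally_R. exists ((b - a) / 2). split; [lra|]. intros y Hy.
      apply Rabs_def2 in Hy. symmetry. apply Hz. unfold t in Hy. lra. }
    assert (H1 : is_derive (fun t => sin (N * t)) t (N * cos (N * t))).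
    { auto_derive; auto. ring. }
    apply is_derive_unique in H0. rewrite (is_derive_unique _ _ _ H1), Hc in H0; auto. lra.
Qed.

(** * Pairs of generators and realizations *)

(** A combination vanishing on an interval has zero derivative there, so its bracket with V, which
    is p W, vanishes too and p = 0. Then q V = 0 and V' = 0 would give W = [V, W] = 0 unless q = 0.
    Both the independence of the generators and the class condition for the whole span follow. *)
Lemma pair_span_vanish (W V : R -> R) (p q a b : R) : affine_pair W V -> a < b ->
  (forall t, a < t < b -> p * W t + q * V t = 0) -> p = 0 /\ q = 0.
Proof.
  intros (HW & HV & Hb & Hn) Hab H.
  destruct (C1_field_lin W V (fun t => p * W t + q * V t) p q HW HV) as [HC HD]; [auto|].
  assert (HD0 : forall t, a < t < b -> p * Derive W t + q * Derive V t = 0).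
  { intros t Ht. rewrite <- HD. apply is_derive_unique.
    apply (is_derive_ext_loc (fun _ => 0)); [|apply (is_derive_const (V := R_NormedModule))].
    apply locally_R. exists (Rmin (t - a) (b - t)). split; [apply Rmin_pos; lra|]. intros y Hy.
    generalize (Rmin_l (t - a) (b - t)) (Rmin_r (t - a) (b - t)). intros.
    apply Rabs_def2 in Hy. symmetry. apply H. lra. }
  assert (Hp : p = 0).
  { apply NNPP. intros Hp. apply (Hn a b Hab). intros t Ht.
    specialize (H t Ht). specialize (HD0 t Ht). specialize (Hb t). unfold bracket in Hb.
    apply (Rmult_eq_reg_l p); auto. rewrite <- Hb.
    replace (p * (V t * Derive W t - Derive V t * W t)) with
      (V t * (p * Derive W t + q * Derive V t) - Derive V t * (p * W t + q * V t)) by ring.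
    rewrite H, HD0. ring. }
  split; auto. apply NNPP. intros Hq. subst p. apply (Hn a b Hab). intros t Ht.
  specialize (H t Ht). specialize (HD0 t Ht).
  assert (E1 : V t = 0) by (apply (Rmult_eq_reg_l q); auto; lra).
  assert (E2 : Derive V t = 0) by (apply (Rmult_eq_reg_l q); auto; lra).
  rewrite <- Hb. unfold bracket. rewrite E1, E2. ring.
Qed.

Lemma pair_realization (W V : R -> R) : affine_pair W V -> realization (span2 W V).
Proof.
  intros HP. generalize HP; intros (HW & HV & Hb & Hn).
  assert (SW : span2 W V W) by (exists 1, 0; intros; ring).
  assert (SV : span2 W V V) by (exists 0, 1; intros; ring).
  split; [|split; [|split]].
  - exists W, V. split; [|tauto]. intros a b H.
    apply (pair_span_vanish W V a b 0 1 HP Rlt_0_1). intros; apply H.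
  - intros u v (a & b & Hu) (c & d & Hv). exists (b * c - a * d), 0. intros t.
    destruct (C1_field_lin W V u a b HW HV Hu) as [_ Du].
    destruct (C1_field_lin W V v c d HW HV Hv) as [_ Dv].
    generalize (Hb t). unfold bracket. rewrite Hu, Hv, Du, Dv. intros E.
    rewrite <- E at 3. ring.
  - exists V, W. split; [auto|split; [auto|]]. apply NNPP. intros H.
    apply (Hn 0 1 Rlt_0_1). intros t _. apply NNPP. intros Ht. apply H. exists t.
    rewrite Hb. exact Ht.
  - intros u (a & b & Hu) [t0 Ht0]. split; [apply (C1_field_lin W V u a b HW HV Hu)|].
    intros x y Hxy H. apply Ht0. rewrite Hu.
    destruct (pair_span_vanish W V a b x y HP Hxy) as [-> ->]; [|ring].
    intros t Ht. rewrite <- Hu. apply H, Ht.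
Qed.

(** Every bracket in the algebra is a multiple of W = [W0, V0], the factor being the determinant of
    the coefficients. Write W = p W0 + q V0. If p = 0, take V = W0 / q; otherwise V = - V0 / p. In
    both cases [V, W] = [W0, V0]. *)
Lemma realization_pair (A : (R -> R) -> Prop) : realization A ->
  exists W V, affine_pair W V /\ forall u, A u <-> span2 W V u.
Proof.
  intros ((W0 & V0 & Hind & HA) & Hcl & (u & v & Hu & Hv & Hnz) & HC).
  assert (AW : A W0) by (apply HA; exists 1, 0; intros; ring).
  assert (AV : A V0) by (apply HA; exists 0, 1; intros; ring).
  assert (CW : C1_field W0).
  { apply HC; auto. apply NNPP. intros H. destruct (Hind 1 0) as [E _]; [|lra].
    intros t. replace (W0 t) with 0; [ring|]. apply NNPP. intros E. apply H. exists t. auto. }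
  assert (CV : C1_field V0).
  { apply HC; auto. apply NNPP. intros H. destruct (Hind 0 1) as [_ E]; [|lra].
    intros t. replace (V0 t) with 0; [ring|]. apply NNPP. intros E. apply H. exists t. auto. }
  set (W := bracket W0 V0).
  assert (HAW : A W) by (apply Hcl; auto).
  assert (HWn : nonzero_field W).
  { apply HA in Hu. apply HA in Hv. destruct Hu as (a & b & Hu), Hv as (c & d & Hv).
    destruct (C1_field_lin W0 V0 u a b CW CV Hu) as [_ Du].
    destruct (C1_field_lin W0 V0 v c d CW CV Hv) as [_ Dv].
    destruct Hnz as [t Ht]. exists t. intros E. apply Ht. unfold bracket.
    rewrite Hu, Hv, Du, Dv. unfold W, bracket in E.
    replace ((a * W0 t + b * V0 t) * (c * Derive W0 t + d * Derive V0 t) -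
      (a * Derive W0 t + b * Derive V0 t) * (c * W0 t + d * V0 t)) with
      ((a * d - b * c) * (W0 t * Derive V0 t - Derive W0 t * V0 t)) by ring.
    rewrite E. ring. }
  destruct (HC W HAW HWn) as [CW1 Hno].
  destruct (proj1 (HA W) HAW) as (p & q & HW).
  destruct (C1_field_lin W0 V0 W p q CW CV HW) as [_ DW].
  assert (EW : forall t, W t = W0 t * Derive V0 t - Derive W0 t * V0 t) by reflexivity.
  destruct (Req_dec p 0) as [Hp|Hp].
  - assert (Hq : q <> 0).
    { intros Hq. destruct HWn as [t Ht]. apply Ht. rewrite HW, Hp, Hq. ring. }
    set (V := fun t => / q * W0 t).
    destruct (C1_field_lin W0 V0 V (/ q) 0 CW CV) as [C1 D1]; [intros t; unfold V; ring|].
    exists W, V. split; [split; [exact CW1|split; [exact C1|split; [|exact Hno]]]|].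
    + intros t. unfold bracket. rewrite D1, DW, HW. unfold V.
      rewrite Hp. specialize (EW t). rewrite HW, Hp in EW.
      transitivity (W0 t * Derive V0 t - Derive W0 t * V0 t); [field; auto|lra].
    + intros w. rewrite HA. split; intros (a & b & Hw).
      * exists (b / q), (a * q). intros t. rewrite Hw, HW, Hp. unfold V. field. auto.
      * exists (b / q), (a * q). intros t. rewrite Hw, HW, Hp. unfold V. field. auto.
  - set (V := fun t => - / p * V0 t).
    destruct (C1_field_lin W0 V0 V 0 (- / p) CW CV) as [C1 D1]; [intros t; unfold V; ring|].
    exists W, V. split; [split; [exact CW1|split; [exact C1|split; [|exact Hno]]]|].
    + intros t. unfold bracket. rewrite D1, DW. specialize (EW t). rewrite EW at 2.
      rewrite HW. unfold V. field. auto.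
    + intros w. rewrite HA. split; intros (a & b & Hw).
      * exists (a / p), (a * q - b * p). intros t. rewrite Hw, HW. unfold V. field. auto.
      * exists (a * p), (a * q - b / p). intros t. rewrite Hw, HW. unfold V. field. auto.
Qed.

Theorem theorem2 (A : (R -> R) -> Prop) (hA : realization A) :
  exists (n : nat) (s : R -> R),
    (1 <= n)%nat /\
    sign_function n s /\
    realization (span2 (fun t => s t * (1 - cos (INR n * t)))
                       (fun t => 1 / INR n * sin (INR n * t))) /\
    equivalent A (span2 (fun t => s t * (1 - cos (INR n * t)))
                        (fun t => 1 / INR n * sin (INR n * t))).
Proof.
  destruct (realization_pair A hA) as (W0 & V0 & HP0 & HA).
  (* [n] is the number of zeros of W0 on the circle, which the blow-ups leave unchanged. *)
  destruct (pair_zero_chain W0 V0 HP0) as (n & z0 & Hz0).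
  destruct (desingularize W0 V0 n z0 A HP0 Hz0 HA) as (W & V & z & HP & Hz & HE & HD).
  destruct (rectify W V n z HP Hz HD) as (F & HL & Hi & HF & Hfc & HFz & Htrig).
  assert (HFc : forall t, continuous F t) by (intros; eapply is_derive_cont, HF).
  destruct (lift_bijective F HL Hi HFc) as (Hbij & K & HFK & HKF & HK).
  assert (Hn1 : (1 <= n)%nat) by apply Hz.
  assert (HN : 0 < INR n) by (apply lt_0_INR; lia).
  (* The sign of W in the new coordinate. It is 0 at the images of the zeros, that is at multiples
     of 2 PI / n, where 1 - cos vanishes. *)
  set (s := fun y => sign (W (K y))).
  assert (Hs0 : forall x, x <> 0 -> sign x * x = Rabs x /\ Rabs (sign x) = 1).
  { intros x Hx. destruct (Rlt_le_dec 0 x) as [Hlt|Hle].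
    - rewrite sign_eq_1, !Rabs_pos_eq by lra. lra.
    - rewrite sign_eq_m1, (Rabs_left x), Rabs_left by lra. lra. }
  assert (Hsm : forall x, sign x * Rabs x = x).
  { intros x. destruct (Rtotal_order x 0) as [H|[->|H]].
    - rewrite sign_eq_m1, Rabs_left by lra. ring.
    - rewrite Rabs_R0. ring.
    - rewrite sign_eq_1, Rabs_pos_eq by lra. ring. }
  assert (HKp : forall y, K (y + 2 * PI) = K y + 2 * PI).
  { intros y. rewrite <- (HKF (K y + 2 * PI)), HL, HFK. auto. }
  assert (Hps : periodic s).
  { intros y. unfold s. rewrite HKp. destruct HP as ((HpW & _) & _). rewrite HpW. auto. }
  assert (HKW : forall y, continuous (fun y => W (K y)) y).
  { intros y. apply continuous_comp; [apply HK|apply C1_field_cont, HP]. }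
  assert (Hsloc : forall y, W (K y) <> 0 -> locally y (fun x => s x = s y)).
  { intros y Hy. apply locally_R.
    destruct (proj1 (continuous_R _ _) (HKW y) (Rabs (W (K y))) (Rabs_pos_lt _ Hy)) as (r & Hr & H).
    exists r. split; auto. intros x Hx. specialize (H x Hx). unfold s.
    apply Rabs_def2 in H. destruct (Rlt_le_dec 0 (W (K y))).
    - rewrite Rabs_pos_eq in H by lra. rewrite !sign_eq_1 by lra. auto.
    - rewrite Rabs_left in H by lra. rewrite !sign_eq_m1 by lra. auto. }
  assert (HP1 : affine_pair (fun t => s t * (1 - cos (INR n * t)))
                            (fun t => 1 / INR n * sin (INR n * t))).
  { apply normal_form_pair; auto.
    - intros y. unfold s. destruct (Req_dec (W (K y)) 0) as [E|E].
      + rewrite E, sign_0, Rabs_R0. lra.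
      + destruct (Hs0 _ E) as [_ ->]. lra.
    - intros y Hy. assert (HWy : W (K y) <> 0).
      { intros E. apply Hy. destruct (Htrig (K y)) as [E' _].
        rewrite E, HFK, Rabs_R0 in E'. lra. }
      split; [|apply Hsloc, HWy]. intros E. destruct (Hs0 _ HWy) as [_ E'].
      unfold s in E. rewrite E, Rabs_R0 in E'. lra. }
  assert (Hcd : forall t, cont_diff_at F t).
  { intros t. apply cont_diff_of with (density (INR n) W V); auto. apply filter_forall, HF. }
  exists n, s. split; [exact Hn1|split; [|split]].
  - split; [exact Hps|]. intros k Hk.
    assert (Hgap : forall y, 2 * PI * INR k / INR n < y < 2 * PI * INR (k + 1) / INR n ->
              z k < K y < z (S k)).
    { intros y Hy. rewrite <- !HFz, Nat.add_1_r in Hy by lia. rewrite <- (HFK y) in Hy.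
      split; apply Rnot_le_lt; intros [Hl|He].
      - apply Hi in Hl. lra.
      - rewrite He in Hy. lra.
      - apply Hi in Hl. lra.
      - rewrite He in Hy. lra. }
    assert (Hnz : forall t, z k < t < z (S k) -> W t <> 0) by (apply Hz; auto).
    destruct (nonzero_sign W (z k) (z (S k))) as [Hs|Hs]; auto.
    { intros t. apply C1_field_cont, HP. }
    + exists 1. split; auto. intros y Hy. apply sign_eq_1, Hs, Hgap, Hy.
    + exists (-1). split; auto. intros y Hy. apply sign_eq_m1, Hs, Hgap, Hy.
  - apply pair_realization, HP1.
  - apply t_trans with (span2 W V); [exact HE|]. apply t_step.
    apply (step_span _ F W V); try apply HP; try apply HP1; try tauto.
    + split; [exact Hbij|split; [exact HFc|split]].
      (* The rectifying map is continuously differentiable everywhere: its derivative tends to 0 at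
         the zeros instead of blowing up. *)
      * exists nil. intros t Ht. exfalso. apply Ht, Hcd.
      * intros t Ht. exfalso. apply Ht, Hcd.
    + intros t _. rewrite (is_derive_unique _ _ _ (HF t)). destruct (Htrig t) as [E1 E2].
      rewrite E1, E2. unfold s. rewrite HKF. split.
      (* sign W times |W| restores W, so the signed normal form is the transform of W itself. *)
      * rewrite <- Rmult_assoc, Hsm. auto.
      * field. lra.
    + intros y. exists 1. split; [lra|]. intros x _ _. exists (K x). split; auto.
Qed.
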